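(* Let $d=2$, $\rho>0$, $\beta>0$, and let $H(r)=\exp(-\beta r^{2})$ for $r>0$ and $H(0)=0$. Fix distinct $x,y\in\mathbb{R}^2$ and consider the random connection model $\mathcal{G}_H$ on $\mathcal{Y}^\star=\mathcal{Y}\cup\{x,y\}$. Then the number $\sigma_3$ of three-hop paths from $x$ to $y$ satisfies $$\mathrm{Var}(\sigma_3)=\mathbb{E}\sigma_3+\frac{\pi^3\rho^3}{\beta^3}\left(\frac14\exp\!\Big(-\frac{\beta\|x-y\|^2}{2}\Big)+\frac16\exp\!\Big(-\frac{3\beta\|x-y\|^2}{4}\Big)\right)+\frac{\pi^2\rho^2}{8\beta^2}\exp\!\big(-\beta\|x-y\|^2\big),$$ where $\mathbb{E}\sigma_3=\frac{\pi^2\rho^2}{3\beta^2}\exp\!\big(-\frac{\beta\|x-y\|^2}{3}\big)$.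
   Context: $\mathcal{Y}$ is a homogeneous Poisson point process on $\mathbb{R}^2$ of intensity $\rho$. The random connection model $\mathcal{G}_H$ on $\mathcal{Y}^\star=\mathcal{Y}\cup\{x,y\}$ is the random graph obtained, conditionally on $\mathcal{Y}$, by joining each unordered pair of distinct points $u,v\in\mathcal{Y}^\star$ by an edge independently with probability $H(\|u-v\|)$ (no self-loops), $\|\cdot\|$ the Euclidean norm. A three-hop path from $x$ to $y$ is an ordered pair $(A,B)$ of distinct points of $\mathcal{Y}$ such that $x\sim A$, $A\sim B$, $B\sim y$ in $\mathcal{G}_H$; $\sigma_3$ is the number of such paths. *)

(* Defs.v *)
From HB Require Import structures.
From mathcomp Require Import all_boot all_order all_algebra.
From mathcomp Require Import all_classical all_reals all_analysis.
Set Implicit Arguments. Unset Strict Implicit. Unset Printing Implicit Defensive.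
Import Order.TTheory GRing.Theory Num.Theory.
Import numFieldNormedType.Exports.
Local Open Scope classical_set_scope.
Local Open Scope ring_scope.

Definition sqdist {R : realType} (p q : R * R) : R :=
  (p.1 - q.1) ^+ 2 + (p.2 - q.2) ^+ 2.
Definition edist {R : realType} (p q : R * R) : R := Num.sqrt (sqdist p q).

Definition leb2 {R : realType} : set (R * R) -> \bar R :=
  (@lebesgue_measure R \x @lebesgue_measure R)%E.

(** Poisson probability mass function with mean [r >= 0]
    (valid also for r = 0, where it is the Dirac mass at 0). *)
Definition pois_pmf {R : realType} (r : R) (k : nat) : R :=
  r ^+ k / (k`!)%:R * expR (- r).

Definition pcount {d} {T : measurableType d} {R : realType}
  (X : nat -> T -> R * R) (B : set (R * R)) (w : T) : \bar R :=
  (\sum_(m <oo) (\1_B (X m w))%:E)%E.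

(** The random configuration Y = {X_0, X_1, ...} (counted with multiplicity)
    is a homogeneous Poisson point process on R^2 with intensity rho:
    counts of finitely many pairwise disjoint bounded-measure Borel sets are
    independent Poisson variables with means rho * Leb(B_i). *)
Definition is_PPP {d} {T : measurableType d} {R : realType}
  (P : probability T R) (rho : R) (X : nat -> T -> R * R) : Prop :=
  (forall m, measurable_fun setT (X m)) /\
  forall (k : nat) (B : 'I_k -> set (R * R)) (n : 'I_k -> nat),
    (forall i, measurable (B i)) ->
    (forall i, (leb2 (B i) < +oo)%E) ->
    (forall i j, i != j -> B i `&` B j = set0) ->
    P (\bigcap_(i in [set: 'I_k]) [set w | pcount X (B i) w = ((n i)%:R)%:E])
    = (\prod_(i < k) pois_pmf (rho * fine (leb2 (B i))) (n i))%:E.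

Definition Xevent {d} {T : measurableType d} {R : realType}
  (X : nat -> T -> R * R) (sx : seq (nat * set (R * R))) : set T :=
  [set w | forall c, c \in sx -> X c.1 w \in c.2].

Definition Uevent {d} {T : measurableType d} {R : realType}
  (U : nat -> nat -> T -> R) (c : (nat * nat) * set R) : set T :=
  [set w | U c.1.1 c.1.2 w \in c.2].

Definition iid_uniform_indep {d} {T : measurableType d} {R : realType}
  (P : probability T R) (X : nat -> T -> R * R) (U : nat -> nat -> T -> R)
  : Prop :=
  (forall i j, measurable_fun setT (U i j)) /\
  (forall i j (A : set R), measurable A ->
     P [set w | U i j w \in A] = @lebesgue_measure R (A `&` `[0, 1]%classic)) /\
  (forall (sx : seq (nat * set (R * R))) (su : seq ((nat * nat) * set R)),
     (forall c, c \in sx -> measurable c.2) ->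
     (forall c, c \in su -> measurable c.2) ->
     uniq (map fst su) ->
     P (Xevent X sx `&` \bigcap_(c in [set` su]) Uevent U c)
     = (P (Xevent X sx) * \prod_(c <- su) P (Uevent U c))%E).

Definition Hgauss {R : realType} (beta r : R) : R :=
  if 0 < r then expR (- (beta * r ^+ 2)) else 0.

Definition vpt {d} {T : measurableType d} {R : realType}
  (x y : R * R) (X : nat -> T -> R * R) (v : nat) (w : T) : R * R :=
  match v with 0 => x | 1 => y | m.+2 => X m w end.

(** Random connection model: vertices i <> j are joined iff
    U (min i j) (max i j) <= H(|p_i - p_j|); given the points, the edges are
    independent with probability H(|p_i - p_j|). *)
Definition rcm_edge {d} {T : measurableType d} {R : realType} (beta : R)
  (x y : R * R) (X : nat -> T -> R * R) (U : nat -> nat -> T -> R)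
  (i j : nat) (w : T) : bool :=
  (i != j) &&
  (U (minn i j) (maxn i j) w <= Hgauss beta (edist (vpt x y X i w) (vpt x y X j w))).

(** sigma_3: number of ordered pairs (A, B) of distinct points of Y with
    x ~ A ~ B ~ y.  (Real-valued; it is a.s. finite.) *)
Definition sigma3 {d} {T : measurableType d} {R : realType} (beta : R)
  (x y : R * R) (X : nat -> T -> R * R) (U : nat -> nat -> T -> R) (w : T) : R :=
  fine (\sum_(a <oo) \sum_(b <oo)
    (((a != b) && rcm_edge beta x y X U 0 a.+2 w
       && rcm_edge beta x y X U a.+2 b.+2 w
       && rcm_edge beta x y X U b.+2 1 w)%:R)%:E)%E.

(* Main.v *)
Require Import Defs.
From HB Require Import structures.
From mathcomp Require Import all_boot all_order all_algebra.
From mathcomp Require Import all_classical all_reals all_analysis.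
From mathcomp Require Import measurable_realfun ring lra zify.
Set Implicit Arguments. Unset Strict Implicit. Unset Printing Implicit Defensive.
Import Order.TTheory GRing.Theory Num.Theory.
Import numFieldNormedType.Exports.
Local Open Scope classical_set_scope.
Local Open Scope ring_scope.

(** A path x, A, B, y is a pair of points of the process, so sigma_3 and its square
are sums over tuples of pairwise distinct points: the square of a sum over ordered
pairs splits into one sum over quadruples, four over triples and two over pairs,
according to which points the two paths share.

Given the points, the edges of two such paths are independent, because each edge
reads its own uniform label; averaging the labels out one at a time replaces every
edge by its connection probability.  What remains is governed by the factorial
moment measures of the Poisson process: the sum over distinct k-tuples integrates
to rho^k times Lebesgue measure.  For a product of sets this is computed on the
atoms of the algebra they generate, where the number of distinct tuples is a
polynomial in independent Poisson counts N_j, and n p(n) = lambda p(n - 1) removes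
one factor at a time; uniqueness of product measures does the rest.

The resulting Gaussian integrals follow by completing the square.  Quadruples give
exactly (E sigma_3)^2. *)

(** * Gaussian integrals in the plane *)

(** The points come as an enumeration [X], and the Poisson hypothesis speaks only of counts in
    disjoint sets of finite area. A single tuple of points therefore has no usable law; only the sum
    of the laws of all distinct tuples does, which is why that sum is built as a measure
    ([tuple_law]) and compared with [area] on rectangles with sides of finite area. The labels, by
    contrast, are attached to pairs of indices, so they must be averaged out for each fixed tuple of
    indices, before the sum over tuples is replaced by an integral.

    Finiteness is a second obstacle: [sigma3] applies [fine] to a series that may diverge. All sums
    are kept nonnegative with values in [\bar R], where sums and integrals commute without
    summability, and finiteness almost everywhere is recovered from the finite mean before
    squaring. *)

Section sigma_finite_product.
Context d1 d2 (T1 : measurableType d1) (T2 : measurableType d2) (R : realType).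
Variables (m1 : {sigma_finite_measure set T1 -> \bar R})
          (m2 : {sigma_finite_measure set T2 -> \bar R}).

(** Named so that the product carries a sigma-finite structure and can itself be a factor, up to
    four points of the plane. *)
Definition sfprod : set (T1 * T2) -> \bar R := (m1 \x m2)%E.

HB.instance Definition _ := Measure.on sfprod.

Let sfprod_sigma_finite : sigma_finite setT sfprod.
Proof.
have /sigma_finiteP[F [TF ndF Foo]] := sigma_finiteT m1.
have /sigma_finiteP[G [TG ndG Goo]] := sigma_finiteT m2.
exists (fun n => F n `*` G n).
  rewrite -setXTT TF TG; apply/seteqP; split=> -[u v].
    move=> [/= [n _ Fnu] [k _ Gkv]]; exists (maxn n k) => //; split.
    - by move: u Fnu; exact/subsetPset/ndF/leq_maxl.
    - by move: v Gkv; exact/subsetPset/ndG/leq_maxr.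
  by move=> [n _ []/= ? ?]; split; exists n.
move=> k; have [? ?] := Foo k; have [? ?] := Goo k.
split; first exact: measurableX.
by rewrite /sfprod product_measure1E// lte_mul_pinfty// ge0_fin_numE.
Qed.

HB.instance Definition _ :=
  Measure_isSigmaFinite.Build _ _ _ sfprod sfprod_sigma_finite.

End sigma_finite_product.

Notation plane R := (measurableTypeR R * measurableTypeR R)%type.

Definition area (R : realType) : {sigma_finite_measure set (plane R) -> \bar R} :=
  sfprod (@lebesgue_measure R) (@lebesgue_measure R).

Section gaussian_integrals.
Context {R : realType}.
Implicit Types (a b c s : R) (p q z : R * R).

(** This is the normalisation of the normal density of variance 1/(2s), multiplied by the inverse of
    its peak. *)
Lemma integral_gauss s m : 0 < s ->
  (\int[lebesgue_measure]_t (expR (- (s * (t - m) ^+ 2)))%:E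
   = (Num.sqrt (pi / s))%:E)%E.
Proof.
move=> s0; have s2 : 0 < 2 * s by rewrite mulr_gt0.
pose sg : R := (Num.sqrt (2 * s))^-1.
have sg0 : 0 < sg by rewrite invr_gt0 sqrtr_gt0.
have sgE : sg ^+ 2 *+ 2 = s^-1.
  by rewrite /sg exprVn sqr_sqrtr ?ltW// -mulr_natr; field; rewrite gt_eqF.
have := integral_normal_pdf m sg.
under eq_integral do rewrite /normal_pdf gt_eqF// /normal_fun sgE invrK EFinM.
rewrite ge0_integralZl//; last 2 first.
- apply/measurable_EFinP; apply: measurableT_comp => //.
  apply: measurable_funM => //; apply: measurableT_comp => //.
  exact: measurable_funX (measurable_funB _ _).
- by rewrite lee_fin invr_ge0 sqrtr_ge0.
have -> : normal_peak sg = (Num.sqrt (pi / s))^-1.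
  by rewrite /normal_peak -sgE [in RHS]mulrnAr [in RHS](mulrC (pi : R)).
move=> H.
have pis0 : 0 < Num.sqrt (pi / s) by rewrite sqrtr_gt0 divr_gt0// pi_gt0.
rewrite -[RHS]mule1 -H muleA -EFinM divff ?gt_eqF// mul1e.
by apply: eq_integral => t _; rewrite mulNr mulrC.
Qed.

Lemma measurable_sqdist p : measurable_fun setT (fun z : plane R => sqdist z p).
Proof.
apply: measurable_funD; apply: (@measurable_funX _ _ _ _ (fun x : plane R => _ - _));
  apply: measurable_funB => //.
Qed.

Lemma sqdistC p q : sqdist p q = sqdist q p.
Proof. rewrite /sqdist; ring. Qed.

Lemma integral_gauss2 s p : 0 < s ->
  (\int[@area R]_z (expR (- (s * sqdist z p)))%:E = (pi / s)%:E)%E.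
Proof.
move=> s0; rewrite /area/= /sfprod fubini_tonelli1; last 2 first.
- apply/measurable_EFinP; do 2 (apply: measurableT_comp => //).
  apply: measurable_funM => //; exact: measurable_sqdist.
- by move=> z; rewrite lee_fin expR_ge0.
under eq_integral => u _.
  rewrite /fubini_F; under eq_integral do rewrite /sqdist/= mulrDr opprD expRD EFinM.
  rewrite ge0_integralZl//; last first.
  - apply/measurable_EFinP; do 2 (apply: measurableT_comp => //).
    apply: measurable_funM => //; exact: measurable_funX (measurable_funB _ _).
  rewrite integral_gauss//; over.
rewrite ge0_integralZr//; last first.
- apply/measurable_EFinP; do 2 (apply: measurableT_comp => //).
  apply: measurable_funM => //; exact: measurable_funX (measurable_funB _ _).
rewrite integral_gauss// -EFinM -expr2 sqr_sqrtr//.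
by rewrite divr_ge0 ?pi_ge0// ltW.
Qed.

Lemma integral_gauss2_conv a c p q : 0 < a -> 0 < c ->
  (\int[@area R]_z (expR (- (a * sqdist z p + c * sqdist z q)))%:E
   = (pi / (a + c) * expR (- (a * c / (a + c) * sqdist p q)))%:E)%E.
Proof.
move=> a0 c0; have ac0 : 0 < a + c by rewrite addr_gt0.
(* The barycentre of [p] and [q] with weights [a] and [c], about which the square completes with
   total rate [a + c]. *)
pose m : R * R := ((a * p.1 + c * q.1) / (a + c), (a * p.2 + c * q.2) / (a + c)).
under eq_integral => z _.
  have -> : a * sqdist z p + c * sqdist z q
      = (a + c) * sqdist z m + a * c / (a + c) * sqdist p q.
    by rewrite /sqdist /m/=; field; rewrite gt_eqF.
  rewrite opprD expRD EFinM; over.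
rewrite ge0_integralZr//; last first.
- apply/measurable_EFinP; do 2 (apply: measurableT_comp => //).
  apply: measurable_funM => //; exact: measurable_sqdist.
by rewrite integral_gauss2.
Qed.

Lemma area_set1 p : @area R [set p] = 0%E.
Proof.
have -> : [set p] = [set p.1] `*` [set p.2].
  by apply/seteqP; split=> [z ->//|[z1 z2] [/= -> ->]]; rewrite -surjective_pairing.
rewrite /area/= /sfprod product_measure1E//.
by rewrite [X in (X * _)%E](@lebesgue_measure_set1 R) mul0e.
Qed.

End gaussian_integrals.

(** * The connection kernel *)

Section connection_kernel.
Context {R : realType}.
Implicit Types (a b c : R) (p q z : plane R).

Definition kern (beta : R) (p q : plane R) : R := Hgauss beta (Defs.edist p q).

Lemma edistC p q : Defs.edist p q = Defs.edist q p.
Proof. by rewrite /Defs.edist sqdistC. Qed.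

Lemma kernC beta p q : kern beta p q = kern beta q p.
Proof. by rewrite /kern edistC. Qed.

Lemma sqdist_ge0 p q : 0 <= sqdist p q.
Proof. by rewrite addr_ge0// sqr_ge0. Qed.

Lemma kern_ge0 beta p q : 0 <= kern beta p q.
Proof. by rewrite /kern /Hgauss; case: ifP => // _; exact: expR_ge0. Qed.

Lemma kern_le1 beta p q : 0 < beta -> kern beta p q <= 1.
Proof.
move=> b0; rewrite /kern /Hgauss; case: ifP => // _.
by rewrite -expR0 ler_expR oppr_le0 mulr_ge0 ?sqr_ge0// ltW.
Qed.

Lemma kernE beta p q : p <> q -> kern beta p q = expR (- (beta * sqdist p q)).
Proof.
move=> pq; rewrite /kern /Hgauss /Defs.edist sqr_sqrtr ?sqdist_ge0// sqrtr_gt0.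
case: ifPn => //; rewrite lt0r sqdist_ge0 andbT negbK => /eqP/eqP.
rewrite paddr_eq0 ?sqr_ge0// !sqrf_eq0 !subr_eq0 => /andP[/eqP p1 /eqP p2].
by case: pq; case: p q p1 p2 => [? ?] [? ?] /= -> ->.
Qed.

Lemma measurable_sqdist2 d (S : measurableType d) (f g : S -> plane R) :
  measurable_fun setT f -> measurable_fun setT g ->
  measurable_fun setT (fun s => sqdist (f s) (g s)).
Proof.
move=> mf mg.
have mc1 (h : S -> plane R) :
    measurable_fun setT h -> measurable_fun setT (fun s => (h s).1 : R).
  by move=> mh; apply: (measurableT_comp (f := fst : plane R -> R)).
have mc2 (h : S -> plane R) :
    measurable_fun setT h -> measurable_fun setT (fun s => (h s).2 : R).
  by move=> mh; apply: (measurableT_comp (f := snd : plane R -> R)).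
apply: measurable_funD; apply: (@measurable_funX _ _ _ _ (fun s : S => _ - _));
  apply: measurable_funB; by [exact: mc1|exact: mc2].
Qed.

Lemma measurable_kern d (S : measurableType d) (beta : R) (f g : S -> plane R) :
  measurable_fun setT f -> measurable_fun setT g ->
  measurable_fun setT (fun s => kern beta (f s) (g s)).
Proof.
move=> mf mg; have msq := measurable_sqdist2 mf mg.
have me : measurable_fun setT (fun s => Defs.edist (f s) (g s)).
  by apply: measurableT_comp => //; apply: continuous_measurable_fun; exact: sqrt_continuous.
apply: measurable_fun_ifT => //; first exact: measurable_fun_ltr.
do 2 (apply: measurableT_comp => //); apply: measurable_funM => //.
exact: measurable_funX.
Qed.

Lemma integral_gauss2_off (N : set (plane R)) (F : plane R -> R) k a c p q :
  measurable N -> area R N = 0%E -> measurable_fun setT F -> 0 <= k ->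
  0 < a -> 0 < c ->
  (forall z, ~ N z -> F z = k * expR (- (a * sqdist z p + c * sqdist z q))) ->
  (\int[area R]_z (F z)%:E
   = (k * (pi / (a + c) * expR (- (a * c / (a + c) * sqdist p q))))%:E)%E.
Proof.
move=> mN N0 mF k0 a0 c0 FE.
have mG : measurable_fun setT
    (fun z : plane R => (expR (- (a * sqdist z p + c * sqdist z q)))%:E).
  apply/measurable_EFinP; do 2 (apply: measurableT_comp => //).
  by apply: measurable_funD; apply: measurable_funM => //; exact: measurable_sqdist.
rewrite EFinM -(integral_gauss2_conv p q a0 c0) -ge0_integralZl//; last first.
apply: ae_eq_integral => //.
- exact/measurable_EFinP.
- exact: measurable_funeM.
- exists N; split => // z /= /not_implyP[_ Fz]; apply: contrapT => Nz.
  by apply: Fz; rewrite FE.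
Qed.

Lemma measurable_set1_plane p : measurable [set p].
Proof.
have -> : [set p] = [set p.1] `*` [set p.2].
  by apply/seteqP; split=> [z ->//|[z1 z2] [/= -> ->]]; rewrite -surjective_pairing.
exact: measurableX.
Qed.

Lemma area_set3 p q z : area R [set p; q; z] = 0%E.
Proof.
have m1 := measurable_set1_plane.
rewrite measureU0//; [|exact: measurableU|exact: area_set1].
by rewrite measureU0//; exact: area_set1.
Qed.

(* [kern] vanishes on the diagonal, hence differs from the Gaussian on a null set. *)
Lemma integral_gauss2_off3 (o p q : plane R) (F : plane R -> R) k a c p' q' :
  measurable_fun setT F -> 0 <= k -> 0 < a -> 0 < c ->
  (forall z, z <> o -> z <> p -> z <> q ->
    F z = k * expR (- (a * sqdist z p' + c * sqdist z q'))) ->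
  (\int[area R]_z (F z)%:E
   = (k * (pi / (a + c) * expR (- (a * c / (a + c) * sqdist p' q'))))%:E)%E.
Proof.
move=> mF k0 a0 c0 FE; apply: (@integral_gauss2_off [set o; p; q]) => //.
- by do ! apply: measurableU; exact: measurable_set1_plane.
- exact: area_set3.
- by move=> z /= /not_orP[/not_orP[? ?] ?]; exact: FE.
Qed.

Variables (beta : R) (x y : plane R).
Hypothesis beta0 : 0 < beta.
Local Notation K := (kern beta).
Local Notation D2 := (sqdist x y).

Ltac posnz :=
  have ? := beta0;
  repeat lazymatch goal with |- is_true (_ && _) => apply/andP; split end;
  apply: lt0r_neq0; lra.

(* The closed form of [\int K(p,z) K(z,q) dz]. *)
Definition kern2 p q : R := pi / (2 * beta) * expR (- (beta / 2 * sqdist p q)).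

Lemma kern2_ge0 p q : 0 <= kern2 p q.
Proof. by rewrite mulr_ge0 ?expR_ge0// divr_ge0 ?pi_ge0// mulr_ge0// ltW. Qed.

Lemma kern2C p q : kern2 p q = kern2 q p.
Proof. by rewrite /kern2 sqdistC. Qed.

Lemma integral_kern2 p q :
  (\int[area R]_z (K p z * K z q)%:E = (kern2 p q)%:E)%E.
Proof.
rewrite (@integral_gauss2_off3 p p q _ 1 beta beta p q)//.
- rewrite mul1r /kern2; congr (_ / _ * expR (- (_ * _)))%:E; first ring.
  by field; posnz.
- by apply: measurable_funM; apply: measurable_kern.
- move=> z zp _ zq; rewrite kernC !kernE// mul1r opprD expRD//.
Qed.

Lemma measurable_kern2 d (S : measurableType d) (f g : S -> plane R) :
  measurable_fun setT f -> measurable_fun setT g ->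
  measurable_fun setT (fun s => kern2 (f s) (g s)).
Proof.
move=> mf mg; apply: measurable_funM => //.
do 2 (apply: measurableT_comp => //); apply: measurable_funM => //.
exact: measurable_sqdist2.
Qed.

(** [kern2] has rate beta/2, so the convolution has rate beta (beta/2) / (beta + beta/2) = beta/3,
    the exponent of the mean. *)
Lemma integral_path3 :
  (\int[area R]_p (K x p * kern2 p y)%:E
   = (pi ^+ 2 / (3 * beta ^+ 2) * expR (- (beta * D2 / 3)))%:E)%E.
Proof.
have h0 : 0 < beta / 2 by rewrite divr_gt0.
rewrite (@integral_gauss2_off3 x x x _ (pi / (2 * beta)) beta (beta / 2) x y)//.
- congr (_%:E); rewrite [LHS]mulrA; congr (_ * expR (- _)); last by field; posnz.
  by move: (pi : R) => P; field; posnz.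
- by apply: measurable_funM; [exact: measurable_kern|exact: measurable_kern2].
- by rewrite divr_ge0 ?pi_ge0// mulr_ge0// ltW.
- by move=> z zx _ _; rewrite kernC kernE// /kern2 opprD expRD mulrCA.
Qed.

(** The vertex [z] shared by two paths is joined to [p] once and has two independent two-hop
    continuations to [q]. The square of [kern2] has rate beta, so rates beta and beta combine to
    beta/2. *)
Lemma integral_fork (p q : plane R) :
  (\int[area R]_z (K p z * (kern2 z q * kern2 z q))%:E
   = (pi ^+ 3 / (8 * beta ^+ 3) * expR (- (beta * sqdist p q / 2)))%:E)%E.
Proof.
rewrite (@integral_gauss2_off3 p p p _ ((pi / (2 * beta)) ^+ 2) beta beta p q)//.
- congr (_%:E); rewrite [LHS]mulrA; congr (_ * expR (- _)); last by field; posnz.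
  by move: (pi : R) => P; field; posnz.
- apply: measurable_funM; first exact: measurable_kern.
  by apply: measurable_funM; exact: measurable_kern2.
- by rewrite sqr_ge0.
- move=> z zp _ _; rewrite kernC kernE// /kern2 mulrACA -expRD -expr2 mulrCA -expRD.
  by congr (_ * expR _); field.
Qed.

(** The shared vertex [z] has an edge and a two-hop connection to each of [x] and [y]: rate beta +
    beta/2 towards both, which combine to 3 beta/4. *)
Lemma integral_middle :
  (\int[area R]_z (K x z * K z y * (kern2 x z * kern2 z y))%:E
   = (pi ^+ 3 / (12 * beta ^+ 3) * expR (- (3 * beta * D2 / 4)))%:E)%E.
Proof.
have h0 : 0 < 3 / 2 * beta by rewrite mulr_gt0// divr_gt0.
rewrite (@integral_gauss2_off3 x x y _ ((pi / (2 * beta)) ^+ 2)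
  (3 / 2 * beta) (3 / 2 * beta) x y)//.
- congr (_%:E); rewrite [LHS]mulrA; congr (_ * expR (- _)); last by field; posnz.
  by move: (pi : R) => P; field; posnz.
- apply: measurable_funM; apply: measurable_funM;
    by [exact: measurable_kern|exact: measurable_kern2].
- by rewrite sqr_ge0.
- move=> z zx _ zy; rewrite kernC !kernE// /kern2 (sqdistC x).
  rewrite -expRD mulrACA -expr2 -expRD mulrCA -expRD.
  by congr (_ * expR _); field.
Qed.

(** The graph has the edge [p q] and all four edges joining [p] and [q] to [x] and [y]. About the
    midpoint [m], each of [p] and [q] sees [x] and [y] together as one centre of rate 2 beta, at the
    cost of a factor with exponent -beta D2/2. *)
Lemma integral_diamond :
  (\int[area R]_p \int[area R]_q (K x p * K p q * K q y * (K x q * K p y))%:E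
   = (pi ^+ 2 / (8 * beta ^+ 2) * expR (- (beta * D2)))%:E)%E.
Proof.
pose m : plane R := ((x.1 + y.1) / 2, (x.2 + y.2) / 2).
have mE z : sqdist z x + sqdist z y = 2 * sqdist z m + D2 / 2.
  by rewrite /sqdist /m/=; field.
have b2 : 0 < 2 * beta by rewrite mulr_gt0.
(* The rate left for [p] after integrating [q]: beta (2 beta) / (beta + 2 beta). Both Gaussians in
   [p] are then centred at [m], so no further exponent appears. *)
have b3 : 0 < 2 / 3 * beta by rewrite mulr_gt0// divr_gt0.
under eq_integral => p _.
  rewrite (@integral_gauss2_off3 p x y _ (K x p * K p y * expR (- (beta * D2 / 2)))
    beta (2 * beta) p m)//; first over.
  - by do ! apply: measurable_funM; exact: measurable_kern.
  - by rewrite !mulr_ge0 ?expR_ge0// kern_ge0.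
  - move=> z zp zx zy.
    rewrite (_ : K x p * K p z * K z y * _
      = K x p * K p y * (K z p * (K z x * K z y))); last first.
      by rewrite (kernC _ z p) (kernC _ z x); ring.
    rewrite (kernE _ zp) (kernE _ zx) (kernE _ zy) -[RHS]mulrA -!expRD.
    by congr (_ * expR _); rewrite -[in LHS](opprD (beta * _)) -mulrDr mE; field.
rewrite (@integral_gauss2_off3 x x y _ (expR (- (beta * D2)) * (pi / (3 * beta)))
    (2 * beta) (2 / 3 * beta) m m)//.
- rewrite /= (_ : sqdist m m = 0) ?mulr0 ?oppr0 ?expR0; last by rewrite /sqdist; ring.
  by move: (pi : R) (expR _) => P E; congr (_%:E); field; posnz.
- do ! apply: measurable_funM => //; try exact: measurable_kern.
  do 2 (apply: measurableT_comp => //); apply: measurable_funM => //.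
  exact: measurable_sqdist.
- by rewrite mulr_ge0 ?expR_ge0// divr_ge0 ?pi_ge0// mulr_ge0// ltW.
- move=> z zx _ zy; rewrite kernC !kernE//.
  rewrite (_ : beta + 2 * beta = 3 * beta); last by ring.
  move: (pi / _) => P; rewrite [LHS]mulrCA -!expRD [RHS]mulrAC -expRD [RHS]mulrC.
  congr (_ * expR _); rewrite -[in LHS](opprD (beta * sqdist z x)) -mulrDr mE.
  by field; posnz.
Qed.

End connection_kernel.

(** * Uniqueness of product measures *)

Definition pushm d1 d2 (T1 : measurableType d1) (T2 : measurableType d2)
    (R : realType) (m : {measure set T1 -> \bar R}) (f : T1 -> T2)
    (mf : measurable_fun setT f) : {measure set T2 -> \bar R} :=
  measure_function_pushforward__canonical__measure_function_Measure m mf.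

Section product_uniqueness.
Local Open Scope ereal_scope.
Context d1 d2 (T1 : measurableType d1) (T2 : measurableType d2) (R : realType).
Variables (m1 : {sigma_finite_measure set T1 -> \bar R})
          (m2 : {sigma_finite_measure set T2 -> \bar R}).

(** Rectangles with sides of finite measure form a pi-system that generates the product
    sigma-algebra and exhausts the space. Only such sides are tested, because the Poisson hypothesis
    covers no others; [c] will be a power of the intensity. *)
Lemma sfprod_unique (c : R) (m' : {measure set (T1 * T2) -> \bar R}) : (0 <= c)%R ->
  (forall A B, measurable A -> measurable B -> m1 A < +oo -> m2 B < +oo ->
    m' (A `*` B) = c%:E * (m1 A * m2 B)) ->
  forall S, measurable S -> m' S = c%:E * sfprod m1 m2 S.
Proof.
move=> c0 m'E.
have /sigma_finiteP[F [TF ndF Foo]] := sigma_finiteT m1.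
have /sigma_finiteP[G [TG ndG Goo]] := sigma_finiteT m2.
pose C : set (set (T1 * T2)) := [set S | exists A B,
  [/\ measurable A, measurable B, m1 A < +oo, m2 B < +oo & S = A `*` B]].
have CI : setI_closed C.
  move=> _ _ [A [B [mA mB A1 B1 ->]]] [A' [B' [mA' mB' A1' B1' ->]]].
  exists (A `&` A'), (B `&` B'); split; rewrite ?setXI//.
  - exact: measurableI.
  - exact: measurableI.
  - by apply: le_lt_trans A1; rewrite le_measure ?inE//; exact: measurableI.
  - by apply: le_lt_trans B1; rewrite le_measure ?inE//; exact: measurableI.
have CFG A B n : measurable A -> measurable B -> C ((A `&` F n) `*` (B `&` G n)).
  move=> mA mB; have [mF Fo] := Foo n; have [mG Go] := Goo n.
  exists (A `&` F n), (B `&` G n); split => //; try exact: measurableI.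
  - by apply: le_lt_trans Fo; rewrite le_measure ?inE//; exact: measurableI.
  - by apply: le_lt_trans Go; rewrite le_measure ?inE//; exact: measurableI.
(* Truncations recover rectangles with arbitrary sides, so the finite ones still generate
   everything. *)
have cupFG A B : \bigcup_n ((A `&` F n) `*` (B `&` G n)) = A `*` B.
  apply/seteqP; split=> [[u v] [n _ [[/= ? ?] [? ?]]]|[u v] [/= Au Bv]]; first by [].
  have : setT u by []. rewrite TF => -[i _ Fi].
  have : setT v by []. rewrite TG => -[j _ Gj].
  exists (maxn i j) => //; split; split => //=.
  - by move: (u) Fi; exact/subsetPset/ndF/leq_maxl.
  - by move: (v) Gj; exact/subsetPset/ndG/leq_maxr.
move=> S mS.
rewrite -[RHS]/(mscale (NngNum c0) (sfprod m1 m2) S).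
apply: (measure_unique C (fun n => F n `*` G n)) => //.
- rewrite measurable_prod_measurableType; apply/seteqP; split.
    apply: smallest_sub; first exact: smallest_sigma_algebra.
    move=> _ [A mA [B mB <-]]; rewrite -cupFG.
    have [_ _ sU] : sigma_algebra setT <<s C >> by exact: smallest_sigma_algebra.
    by apply: sU => n; apply: sub_gen_smallest; exact: CFG.
  apply: smallest_sub; first exact: smallest_sigma_algebra.
  move=> _ [A [B [mA mB _ _ ->]]]; apply: sub_gen_smallest.
  by exists A => //; exists B.
- by move=> n; have := CFG setT setT n measurableT measurableT; rewrite !setTI.
- by have := cupFG setT setT; rewrite setXTT; under eq_bigcupr do rewrite !setTI.
- move=> _ [A [B [mA mB A1 B1 ->]]].
  by rewrite m'E//; congr (_ * _); exact/esym/product_measure1E.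
- move=> n; have [mF Fo] := Foo n; have [mG Go] := Goo n.
  by rewrite m'E// !lte_mul_pinfty// ?ge0_fin_numE// ?mule_ge0// lte_mul_pinfty// ge0_fin_numE.
Qed.

Section slice.
Variables (m' : {measure set (T1 * T2) -> \bar R}) (B : set T2).
Hypothesis mB : measurable B.

Let mTB : measurable ([set: T1] `*` B). Proof. exact: measurableX. Qed.

Definition slice : {measure set T1 -> \bar R} :=
  pushm (mrestr m' mTB) (@measurable_fst _ _ T1 T2).

Lemma sliceE A : slice A = m' (A `*` B).
Proof.
rewrite /slice/= /pushforward /mrestr; congr (m' _).
by apply/seteqP; split=> [[u v] [/= ? [_ ?]]|[u v] [/= ? ?]].
Qed.
End slice.

End product_uniqueness.

Section plane_products.
Local Open Scope ereal_scope.
Context {R : realType}.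
Local Notation L := (area R).
Definition area2 := sfprod L L.
Definition area3 := sfprod area2 L.
Definition area4 := sfprod area3 L.
Implicit Types A B C D : set (plane R).
Local Notation finite A := (measurable A /\ L A < +oo).

Lemma area2_unique (c : R) (m : {measure set (plane R * plane R) -> \bar R}) : (0 <= c)%R ->
  (forall A B, finite A -> finite B -> m (A `*` B) = c%:E * (L A * L B)) ->
  forall S, measurable S -> m S = c%:E * area2 S.
Proof. by move=> c0 mE; apply: sfprod_unique => // A B mA mB A1 B1; exact: mE. Qed.

Lemma area3_unique (c : R)
    (m : {measure set (plane R * plane R * plane R) -> \bar R}) : (0 <= c)%R ->
  (forall A B C, finite A -> finite B -> finite C ->
    m (A `*` B `*` C) = c%:E * (L A * L B * L C)) ->
  forall S, measurable S -> m S = c%:E * area3 S.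
Proof.
move=> c0 mE; apply: sfprod_unique => // S C mS mC S1 C1.
have k0 : (0 <= fine (L C))%R by rewrite fine_ge0.
rewrite -(sliceE m mC) (@area2_unique (c * fine (L C))%R) ?mulr_ge0//=.
- by rewrite EFinM fineK ?ge0_fin_numE// [LHS]muleAC [RHS]muleA.
- move=> A B fA fB; rewrite sliceE mE//= EFinM fineK ?ge0_fin_numE//.
  by rewrite [RHS]muleAC [LHS]muleA.
Qed.

Lemma area4_unique (c : R)
    (m : {measure set (plane R * plane R * plane R * plane R) -> \bar R}) : (0 <= c)%R ->
  (forall A B C D, finite A -> finite B -> finite C -> finite D ->
    m (A `*` B `*` C `*` D) = c%:E * (L A * L B * L C * L D)) ->
  forall S, measurable S -> m S = c%:E * area4 S.
Proof.
move=> c0 mE; apply: sfprod_unique => // S D mS mD S1 D1.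
have k0 : (0 <= fine (L D))%R by rewrite fine_ge0.
rewrite -(sliceE m mD) (@area3_unique (c * fine (L D))%R) ?mulr_ge0//=.
- by rewrite EFinM fineK ?ge0_fin_numE// [LHS]muleAC [RHS]muleA.
- move=> A B C fA fB fC; rewrite sliceE mE//= EFinM fineK ?ge0_fin_numE//.
  by rewrite [RHS]muleAC [LHS]muleA.
Qed.

End plane_products.

Local Open Scope ereal_scope.

(** * Sums over distinct tuples *)

Section distinct_sums.
Context {R : realType}.
Implicit Types (k : nat) (u v : seq nat) (phi psi : seq nat -> \bar R).

(* The index chosen last is the head of the list passed to [phi]. *)
Fixpoint dsum k v phi : \bar R :=
  if k is k'.+1 then \sum_(a <oo | a \notin v) dsum k' (a :: v) phi else phi v.

Lemma dsum_ge0 k v phi : (forall u, 0 <= phi u) -> 0 <= dsum k v phi.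
Proof.
move=> p0; elim: k v => //= k IH v.
by apply: nneseries_ge0 => n _ _; exact: IH.
Qed.

(** Only duplicate-free lists of full length have to be compared; this is where distinctness of the
    vertices becomes available. *)
Lemma eq_dsum k v phi psi : uniq v ->
  (forall u, uniq u -> size u = (k + size v)%N -> phi u = psi u) ->
  dsum k v phi = dsum k v psi.
Proof.
elim: k v => [|k IH] v uv pp /=; first exact: pp.
apply: eq_eseriesr => a av; apply: IH; first by rewrite /= av.
by move=> u uu su; apply: pp => //; rewrite su/= addSnnS.
Qed.

Lemma dsumD k v phi psi : (forall u, 0 <= phi u) -> (forall u, 0 <= psi u) ->
  dsum k v (fun u => phi u + psi u) = dsum k v phi + dsum k v psi.
Proof.
move=> p0 q0; elim: k v => //= k IH v.
rewrite -nneseriesD//; last 2 first.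
- by move=> n _ _; exact: dsum_ge0.
- by move=> n _ _; exact: dsum_ge0.
by apply: eq_eseriesr => a _.
Qed.

Lemma dsumZl k v phi (c : R) : (forall u, 0 <= phi u) ->
  dsum k v (fun u => c%:E * phi u) = c%:E * dsum k v phi.
Proof.
move=> p0; elim: k v => //= k IH v.
rewrite -nneseriesZl//; last by move=> n _; exact: dsum_ge0.
by apply: eq_eseriesr => a _.
Qed.

Lemma dsum_add k l v phi :
  dsum (k + l) v phi = dsum k v (fun u => dsum l u phi).
Proof. by elim: k v => //= k IH v; apply: eq_eseriesr => a _. Qed.

End distinct_sums.

Section integral_dsum.
Context d (T : measurableType d) {R : realType} (P : {measure set T -> \bar R}).
Variable phi : T -> seq nat -> \bar R.
Hypothesis mphi : forall u, measurable_fun setT (phi ^~ u).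
Hypothesis phi0 : forall w u, 0 <= phi w u.

Lemma measurable_dsum k v : measurable_fun setT (fun w => dsum k v (phi w)).
Proof.
elim: k v => [|k IH] v /=; first exact: mphi.
apply: ge0_emeasurable_sum => // a w _ _; exact: dsum_ge0.
Qed.

Lemma integral_dsum k v :
  \int[P]_w dsum k v (phi w) = dsum k v (fun u => \int[P]_w phi w u).
Proof.
elim: k v => //= k IH v.
transitivity (\int[P]_w
    \sum_(a <oo) (if a \notin v then dsum k (a :: v) (phi w) else 0)).
  by apply: eq_integral => w _; rewrite eseries_mkcond.
rewrite integral_nneseries//; last 2 first.
- by move=> a; case: (a \notin v) => //; exact: measurable_dsum.
- by move=> a w _; case: (a \notin v) => //; exact: dsum_ge0.
rewrite [RHS]eseries_mkcond; apply: eq_eseriesr => a _; case: (a \notin v); first exact: IH.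
by rewrite integral0.
Qed.

End integral_dsum.

Section measure_dsum.
Context d (T : measurableType d) {R : realType}.
Variable mu : seq nat -> {measure set T -> \bar R}.

(** The recursion of [dsum] carried out on measures, so that uniqueness of measures applies to a sum
    over distinct tuples. Excluded indices contribute the zero measure. *)
Fixpoint mdsum k v : {measure set T -> \bar R} :=
  if k is k'.+1 then
    mseries (fun a => if a \notin v then mdsum k' (a :: v) else mzero) 0
  else mu v.

Lemma mdsumE k v A : mdsum k v A = dsum k v (fun u => mu u A).
Proof.
elim: k v => //= k IH v; rewrite /mseries [RHS]eseries_mkcond.
by apply: eq_eseriesr => a _; case: (a \notin v) => //; rewrite -IH.
Qed.

Lemma integral_mdsum k v (f : T -> \bar R) :
  measurable_fun setT f -> (forall x, 0 <= f x) ->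
  \int[mdsum k v]_x f x = dsum k v (fun u => \int[mu u]_x f x).
Proof.
move=> mf f0; elim: k v => //= k IH v.
rewrite ge0_integral_measure_series// [RHS]eseries_mkcond.
apply: eq_eseriesr => a _; case: (a \notin v); first exact: IH.
exact: integral_measure_zero.
Qed.

End measure_dsum.

(** * Factorial moments of Poisson processes *)

Section counting_distinct_tuples.
Context {R : realType} {S : Type} (z : nat -> S) (m : nat) (A : 'I_m -> set S).
Implicit Types (b : {set 'I_m}) (bs : seq {set 'I_m}) (n : {ffun 'I_m -> nat}).
Hypothesis disjA : forall i j, i != j -> A i `&` A j = set0.

Fixpoint tuple_sum (Bs : seq (set S)) (v : seq nat) : \bar R :=
  if Bs is B :: Bs' then
    \sum_(a <oo | a \notin v) ((\1_B (z a))%:E * tuple_sum Bs' (a :: v))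
  else 1.

Definition decr (j : 'I_m) n : {ffun 'I_m -> nat} := [ffun i => n i - (i == j)]%N.
Definition incr (j : 'I_m) n : {ffun 'I_m -> nat} := [ffun i => n i + (i == j)]%N.

(** For one atom used k times this is the falling factorial n (n - 1) ... (n - k + 1). An empty atom
    contributes 0 through the factor [n j], so the truncated subtraction in [decr] is harmless. *)
Fixpoint tuple_count bs n : nat :=
  if bs is b :: bs' then (\sum_(j in b) n j * tuple_count bs' (decr j n))%N else 1%N.

Definition cup b : set S := \bigcup_(j in [set` b]) A j.

Definition count_off (v : seq nat) (j : 'I_m) : \bar R :=
  \sum_(a <oo | a \notin v) (\1_(A j) (z a))%:E.

Lemma tuple_sum_ge0 Bs v : 0 <= tuple_sum Bs v.
Proof.
elim: Bs v => //= B Bs IH v; apply: nneseries_ge0 => a _ _.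
by rewrite mule_ge0// lee_fin.
Qed.

Lemma indic_cup b s : \1_(cup b) s = (\sum_(j in b) \1_(A j) s)%R :> R.
Proof.
have [/= [j jb Ajs]|nb] := pselect (cup b s).
  rewrite (bigD1 j)//= big1 ?addr0.
    by rewrite !indicE !mem_set//; exists j.
  move=> i /andP[_ ij]; rewrite indicE memNset// => Ais.
  by have : (A i `&` A j) s by []; rewrite disjA.
rewrite indicE memNset// big1// => j jb; rewrite indicE memNset// => Ajs.
by apply: nb; exists j.
Qed.

Lemma count_off_cons v a i j : a \notin v -> A j (z a) ->
  count_off v i = ((i == j)%:R)%:E + count_off (a :: v) i.
Proof.
move=> av Aja; rewrite /count_off (@nneseriesD1 _ _ a)//.
congr (_ + _).
  rewrite indicE; case: eqVneq => [->|ij]; first by rewrite mem_set.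
  by rewrite memNset// => Aia; have : (A i `&` A j) (z a) by []; rewrite disjA.
by apply: eq_eseriesl => k; rewrite inE negb_or andbC.
Qed.

(** Choosing a point of atom [j] lowers the number left in atom [j] by one and, by disjointness,
    changes no other count. Hence the sum depends on the points only through their counts. *)
Lemma tuple_sum_count bs v n : (forall j, count_off v j = ((n j)%:R)%:E) ->
  tuple_sum [seq cup b | b <- bs] v = ((tuple_count bs n)%:R)%:E.
Proof.
elim: bs v n => //= b bs IH v n nE.
transitivity (\sum_(a <oo) \sum_(j in b)
    ((tuple_count bs (decr j n))%:R%:E *
     (if a \notin v then (\1_(A j) (z a))%:E else 0 : \bar R))).
  rewrite eseries_mkcond; apply: eq_eseriesr => a _.
  case: ifPn => [av|_]; last by rewrite big1// => j _; rewrite mule0.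
  rewrite indic_cup -sumEFin.
  rewrite ge0_sume_distrl; last by move=> j _; rewrite lee_fin.
  apply: eq_bigr => j jb; rewrite muleC.
  have [Aja|nAja] := pselect (A j (z a)); last first.
    by rewrite indicE memNset// !mule0.
  congr (_ * _); apply: IH => i.
  have := nE i; rewrite (count_off_cons _ av Aja) => H.
  rewrite ffunE; move: H; case: eqVneq => [ij|ij]; last by rewrite add0e subn0.
  have : 0 <= count_off (a :: v) i by exact: nneseries_ge0.
  case: (count_off _ _) => // c; rewrite lee_fin => c0 [cE].
  (* The chosen point itself lies in this atom, so subtracting one is exact. *)
  have n1 : (0 < n i)%N.
    by rewrite -(ltr_nat R) -cE ltr_pwDl.
  by rewrite natrB// -cE addrC addrK.
rewrite nneseries_sum; last first.
  by move=> j a _; case: ifP => _; rewrite ?mule0// -EFinM lee_fin mulr_ge0.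
rewrite natr_sum -sumEFin; apply: eq_bigr => j jb.
rewrite nneseriesZl; last by move=> a _; case: ifP.
by rewrite -eseries_mkcond -/(count_off v j) nE -EFinM -natrM mulnC.
Qed.

End counting_distinct_tuples.

(** Lists a sum over count vectors as a series over [nat], the form in which it can be exchanged
    with an integral. *)
Lemma nneseries_countable {R : realType} (I : countType) (h : I -> \bar R) :
  (forall i, 0 <= h i) ->
  \sum_(k <oo) (if @pickle_inv I k is Some i then h i else 0) = \esum_(i in setT) h i.
Proof.
move=> h0.
have H k : 0 <= (if @pickle_inv I k is Some i then h i else 0) by case: (@pickle_inv I k).
rewrite nneseries_esumT//.
rewrite (esumID (range (@pickle I)))// [X in _ + X]esum1 ?adde0; last first.
  move=> k [_ nk]; case E : (@pickle_inv I k) => [i|//].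
  by case: nk; exists i => //; have := @pickle_invK I k; rewrite E.
rewrite setTI (reindex_esum [set: I] _ pickle)//.
  by apply: eq_esum => i _; rewrite pickleK_inv.
split; [by move=> i _; exists i| |by []].
by move=> i j _ _; exact: (pcan_inj (@pickleK_inv I)).
Qed.

Lemma esum_countableZl {R : realType} (I : countType) (c : R) (h : I -> \bar R) :
  (0 <= c)%R -> (forall i, 0 <= h i) ->
  \esum_(i in setT) (c%:E * h i) = c%:E * \esum_(i in setT) h i.
Proof.
move=> c0 h0; rewrite -!nneseries_countable//; last first.
  by move=> i; rewrite mule_ge0// lee_fin.
rewrite -nneseriesZl; last by move=> k _; case: (@pickle_inv I k).
by apply: eq_eseriesr => k _; case: (@pickle_inv I k) => //; rewrite mule0.
Qed.

Section pois_pmf_facts.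
Context {R : realType}.
Implicit Types (r : R) (k : nat).

Lemma pois_pmf_ge0 r k : (0 <= r)%R -> (0 <= pois_pmf r k)%R.
Proof. by move=> r0; rewrite mulr_ge0 ?expR_ge0// divr_ge0// exprn_ge0. Qed.

Lemma pois_pmf_succ r k : (k.+1%:R * pois_pmf r k.+1 = r * pois_pmf r k)%R.
Proof.
rewrite /pois_pmf factS natrM exprS; have k0 : (k.+1%:R != 0 :> R)%R by rewrite pnatr_eq0.
have f0 : (k`!%:R != 0 :> R)%R by rewrite pnatr_eq0 -lt0n fact_gt0.
by move: (k.+1%:R)%R k0 (k`!%:R)%R f0 => c c0 f f0; field; rewrite f0 c0.
Qed.

Lemma nneseries_pois_pmf r : (0 <= r)%R -> \sum_(k <oo) (pois_pmf r k)%:E = 1.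
Proof.
move=> r0; rewrite [RHS](_ : _ = (expR (- r))%:E * (expR r)%:E); last first.
  by rewrite -EFinM expRN mulVf ?gt_eqF ?expR_gt0.
under eq_eseriesr do rewrite /pois_pmf EFinM muleC.
rewrite /= nneseriesZl/=; last by move=> n _; rewrite lee_fin divr_ge0// exprn_ge0.
congr *%E; rewrite expRE -EFin_lim; last first.
  rewrite /pseries/=; under eq_fun do rewrite mulrC.
  exact: is_cvg_series_exp_coeff.
apply/congr_lim/funext => n/=; rewrite /pseries/= /series/= -sumEFin//.
by under eq_bigr do rewrite mulrC.
Qed.

End pois_pmf_facts.

(** * Factorial moments of independent Poisson counts *)

Section multivariate_poisson.
Context {R : realType} (m : nat) (lam : 'I_m -> R).
Hypothesis lam0 : forall j, (0 <= lam j)%R.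
Implicit Types (b : {set 'I_m}) (bs : seq {set 'I_m}) (n : {ffun 'I_m -> nat}).

Definition mpois n : R := (\prod_(j < m) pois_pmf (lam j) (n j))%R.

Lemma mpois_ge0 n : (0 <= mpois n)%R.
Proof. by apply: prodr_ge0 => j _; exact: pois_pmf_ge0. Qed.

Lemma incrK j : cancel (@incr m j) (@decr m j).
Proof. by move=> n; apply/ffunP => i; rewrite !ffunE addnK. Qed.

Lemma mpois_incr j n : ((n j).+1%:R * mpois (incr j n) = lam j * mpois n)%R.
Proof.
rewrite /mpois (bigD1 j)//= [in RHS](bigD1 j)//= [LHS]mulrA [RHS]mulrA [incr j n j]ffunE eqxx addn1.
rewrite pois_pmf_succ; congr (_ * _)%R; apply: eq_bigr => i ij.
by rewrite ffunE (negbTE ij) addn0.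
Qed.

Hypothesis mpois1 : \esum_(n in setT) (mpois n)%:E = 1.

Lemma esum_tuple_count bs :
  \esum_(n in setT) (mpois n * (tuple_count bs n)%:R)%:E
  = (\prod_(b <- bs) \sum_(j in b) lam j)%R%:E.
Proof.
elim: bs => [|b bs IH]/=.
  by rewrite big_nil -mpois1; apply: eq_esum => n _; rewrite mulr1.
transitivity (\esum_(n in setT) \sum_(j in b)
    (mpois n * (n j * tuple_count bs (decr j n))%:R)%:E).
  by apply: eq_esum => n _; rewrite natr_sum mulr_sumr sumEFin.
rewrite esum_sum; last by move=> n j _ _; rewrite lee_fin mulr_ge0// mpois_ge0.
rewrite big_cons mulr_suml -sumEFin; apply: eq_bigr => j jb.
have F0 n : 0 <= (mpois n * (n j * tuple_count bs (decr j n))%:R)%:E.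
  by rewrite lee_fin mulr_ge0// mpois_ge0.
(* Off the range of [incr j] one has [n j = 0] and the term vanishes; on it, shifting the summation
   trades the factor [n j] for [lam j]. *)
rewrite (esumID (range (@incr m j)))// [X in _ + X]esum1 ?adde0; last first.
  move=> n [_ nj]; case E : (n j) => [|k]; first by rewrite mul0n mulr0.
  case: nj; exists (decr j n) => //; apply/ffunP => i; rewrite !ffunE.
  by case: eqVneq => [->|_]; rewrite ?E ?subn1 ?addn1// subn0 addn0.
rewrite setTI (reindex_esum [set: {ffun 'I_m -> nat}] _ (@incr m j)); last first.
  split; [by move=> n _; exists n| |by []].
  by move=> n n' _ _; exact: (can_inj (incrK j)).
rewrite EFinM -IH -esum_countableZl//; last first.
  by move=> n; rewrite lee_fin mulr_ge0// mpois_ge0.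
apply: eq_esum => n _; rewrite incrK ffunE eqxx addn1 -EFinM; congr (_%:E).
by rewrite natrM mulrA [X in (X * _)%R]mulrC mpois_incr mulrA.
Qed.

End multivariate_poisson.

(** * Factorial moment measures of the Poisson process on product sets *)

Section poisson_tuples.
Context d (T : measurableType d) {R : realType} (P : probability T R) (rho : R)
  (X : nat -> T -> R * R).
Hypothesis rho0 : (0 <= rho)%R.
Hypothesis hX : is_PPP P rho X.
Local Notation L := (area R).

Lemma measurable_point i : measurable_fun setT (X i : T -> plane R).
Proof. by have [+ _] := hX; exact. Qed.

Lemma measurable_indic_point i (B : set (plane R)) : measurable B ->
  measurable_fun setT (fun w => (\1_B (X i w))%:E : \bar R).
Proof.
move=> mB; apply/measurable_EFinP.
exact: (measurableT_comp (measurable_indic mB) (measurable_point i)).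
Qed.

Lemma measurable_tuple_sum (Bs : seq (set (plane R))) v :
  (forall B, B \in Bs -> measurable B) ->
  measurable_fun setT (fun w => tuple_sum (X ^~ w) Bs v : \bar R).
Proof.
elim: Bs v => //= B Bs IH v mBs; apply: ge0_emeasurable_sum => //.
  by move=> a w _ _; rewrite mule_ge0// ?lee_fin// tuple_sum_ge0.
move=> a _; apply: emeasurable_funM.
  by apply: measurable_indic_point; apply: mBs; rewrite mem_head.
by apply: IH => C CB; apply: mBs; rewrite inE CB orbT.
Qed.

Section atoms.
Variables (m : nat) (A : 'I_m -> set (plane R)).
Hypothesis mA : forall j, measurable (A j).
Hypothesis finA : forall j, L (A j) < +oo.
Hypothesis disjA : forall i j, i != j -> A i `&` A j = set0.
Implicit Types (b : {set 'I_m}) (bs : seq {set 'I_m}) (n : {ffun 'I_m -> nat}).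

Let lam (j : 'I_m) : R := (rho * fine (L (A j)))%R.

Let lam0 j : (0 <= lam j)%R.
Proof. by rewrite mulr_ge0// fine_ge0. Qed.

Let counts n : set T := \bigcap_(i in [set: 'I_m])
  [set w | pcount X (A i) w = ((n i)%:R)%:E].

Let measurable_pcount (B : set (plane R)) : measurable B ->
  measurable_fun setT (pcount X B).
Proof.
move=> mB; apply: ge0_emeasurable_sum => // a _; exact: measurable_indic_point.
Qed.

Let measurable_counts n : measurable (counts n).
Proof.
apply: fin_bigcap_measurable => // i _; rewrite -[X in measurable X]setTI.
exact: (measurable_pcount (mA i) measurableT (emeasurable_set1 _)).
Qed.

Let P_counts n : P (counts n) = (mpois lam n)%:E.
Proof. by have [_ H] := hX; exact: (H m A n mA finA disjA). Qed.

Let P_count (j : 'I_m) k : P [set w | pcount X (A j) w = (k%:R)%:E] = (pois_pmf (lam j) k)%:E.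
Proof.
have [_ H] := hX.
have := H 1%N (fun=> A j) (fun=> k) (fun=> mA j) (fun=> finA j).
rewrite big_ord1 => <-; last by move=> a b; rewrite !ord1 eqxx.
by congr (P _); apply/seteqP; split=> [w wE i _//|w /(_ ord0)]; exact.
Qed.

(** A count may a priori be infinite, but the disjoint events on which it equals k have Poisson
    probabilities, which already sum to 1. *)
Let ae_counts : {ae P, forall w, exists n, counts n w}.
Proof.
have aej (j : 'I_m) : {ae P, forall w, exists k, pcount X (A j) w = (k%:R)%:E}.
  pose E k := [set w | pcount X (A j) w = (k%:R)%:E].
  have mE k : measurable (E k).
    rewrite -[X in measurable X]setTI.
    exact: (measurable_pcount (mA j) measurableT (emeasurable_set1 _)).
  have mU : measurable (\bigcup_k E k) by exact: bigcup_measurable.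
  exists (~` \bigcup_k E k); split; first exact: measurableC.
    rewrite probability_setC// measure_bigcup//; last first.
      move=> i k _ _ [w [/= Ei Ek]]; move: Ek; rewrite /E/= Ei => -[/eqP].
      by rewrite eqr_nat => /eqP.
    rewrite [X in _ - X](_ : _ = 1) ?subee// -(nneseries_pois_pmf (lam0 j)).
    rewrite (@eq_eseriesl _ _ xpredT) => [|k]; last by rewrite in_setT.
    by apply: eq_eseriesr => k _; exact: P_count.
  by move=> w /= nw [k _ Ek]; apply: nw; exists k.
have : {ae P, forall w, forall j, exists k, pcount X (A j) w = (k%:R)%:E}.
  exact: filter_forall.
apply: filterS => w /choice[n nE].
by exists [ffun j => n j] => j _ /=; rewrite ffunE.
Qed.

Let cuts bs := [seq cup A b | b <- bs].

Lemma measurable_cup b : measurable (cup A b).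
Proof. exact: fin_bigcup_measurable. Qed.

(** Up to a null set the events [counts n] partition the sample space, and on each of them the tuple
    sum is constant. *)
Let integral_tuple_sum_esum bs :
  \int[P]_w tuple_sum (X ^~ w) (cuts bs) [::]
  = \esum_(n in setT) (mpois lam n * (tuple_count bs n)%:R)%:E.
Proof.
pose g n w : \bar R := (\1_(counts n) w)%:E * ((tuple_count bs n)%:R)%:E.
pose h k w : \bar R := if @pickle_inv {ffun 'I_m -> nat} k is Some n then g n w else 0.
have g0 n w : 0 <= g n w by rewrite /g mule_ge0// lee_fin.
have mg n : measurable_fun setT (g n).
  by apply/measurable_EFinP; apply: measurable_funM => //; exact: measurable_indic.
transitivity (\int[P]_w \sum_(k <oo) h k w).
  apply: ae_eq_integral => //.
  - apply: measurable_tuple_sum => B /mapP[b _ ->]; exact: measurable_cup.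
  - apply: ge0_emeasurable_sum => [k w _ _|k _]; rewrite /h; by case: pickle_inv.
  - apply: filterS ae_counts => w [n nw] _.
    rewrite (@tuple_sum_count _ _ _ _ A disjA _ _ n); last first.
      by move=> j; rewrite -(nw j)//; exact: eq_eseriesl.
    rewrite /h nneseries_countable// (esumID [set n])// setTI esum_set1//.
    rewrite [X in _ + X]esum1 ?adde0; last first.
      move=> n' [_ /= nn']; rewrite /g indicE memNset ?mul0e// => n'w.
      apply: nn'; apply/ffunP => j; have := n'w j I; rewrite /= (nw j)// => -[/eqP].
      by rewrite eqr_nat => /eqP.
    by rewrite /g indicE mem_set// mul1e.
rewrite integral_nneseries//; last 2 first.
- by move=> k; rewrite /h; case: pickle_inv.
- by move=> k w _; rewrite /h; case: pickle_inv.
rewrite -nneseries_countable; last by move=> n; rewrite lee_fin mulr_ge0// mpois_ge0.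
apply: eq_eseriesr => k _; rewrite /h; case: pickle_inv => [n|]; last by rewrite integral0.
rewrite /g ge0_integralZr//; last first.
  by apply/measurable_EFinP; exact: measurable_indic.
by rewrite integral_indic// setIT [X in X * _](P_counts n) -EFinM.
Qed.

Lemma integral_tuple_sum_atoms bs :
  \int[P]_w tuple_sum (X ^~ w) (cuts bs) [::]
  = (\prod_(b <- bs) \sum_(j in b) lam j)%R%:E.
Proof.
rewrite integral_tuple_sum_esum esum_tuple_count//.
(* For the empty list the integrand is 1, so this instance says that the weights [mpois] sum to
   1. *)
have := integral_tuple_sum_esum [::].
rewrite /= integral_cst// mul1e => H.
rewrite -[RHS](@probability_setT _ _ _ P) [RHS]H.
by apply: eq_esum => n _; rewrite mulr1.
Qed.

Let sum_lam b : (\sum_(j in b) lam j = rho * fine (L (cup A b)))%R.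
Proof.
rewrite -mulr_sumr; congr (_ * _)%R; apply: EFin_inj.
have mI (C : set (plane R)) : measurable C ->
    measurable_fun setT (fun z => (\1_C z)%:E : \bar R).
  by move=> mC; apply/measurable_EFinP; exact: measurable_indic.
have LcupE : L (cup A b) = \sum_(j in b) L (A j).
  rewrite -[cup A b]setIT -integral_indic//; last exact: measurable_cup.
  under eq_integral do rewrite (indic_cup disjA) -sumEFin -big_enum.
  rewrite ge0_integral_sum//; last by move=> j; exact: mI.
  rewrite big_enum/=.
  by apply: eq_bigr => j _; rewrite integral_indic// setIT.
have fA j : ((fine (L (A j)))%:E = L (A j)) by rewrite fineK// ge0_fin_numE.
have -> : L (cup A b) = (\sum_(j in b) fine (L (A j)))%R%:E.
  by rewrite LcupE -sumEFin; apply: eq_bigr => j _; rewrite fA.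
by [].
Qed.

Lemma integral_tuple_sum_cups bs :
  \int[P]_w tuple_sum (X ^~ w) (cuts bs) [::]
  = (\prod_(B <- cuts bs) (rho * fine (L B)))%R%:E.
Proof.
rewrite integral_tuple_sum_atoms big_map; congr (_%:E).
by apply: eq_bigr => b _; exact: sum_lam.
Qed.

End atoms.

(** The entries of [Bs] may overlap or repeat, while independent counts are given for disjoint sets
    only; hence the passage to atoms. *)
Lemma integral_tuple_sum (Bs : seq (set (plane R))) :
  (forall B, B \in Bs -> measurable B /\ L B < +oo) ->
  \int[P]_w tuple_sum (X ^~ w) Bs [::] = (\prod_(B <- Bs) (rho * fine (L B)))%R%:E.
Proof.
move=> hBs; pose k := size Bs; pose B (i : 'I_k) := tnth (in_tuple Bs) i.
have {}hBs i : measurable (B i) /\ L (B i) < +oo by apply: hBs; exact: mem_tnth.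
(* The atoms of the algebra generated by [Bs], except the unbounded one. *)
pose atom (s : {set 'I_k}) : set (plane R) := if s == finset.set0 then set0 else
  \bigcap_(i in [set: 'I_k]) (if i \in s then B i else ~` B i).
pose A (j : 'I_#|{set 'I_k}|) := atom (enum_val j).
have mA j : measurable (A j).
  rewrite /A /atom; case: ifP => // _; apply: fin_bigcap_measurable => // i _.
  by case: ifP => _; [|apply: measurableC]; have [] := hBs i.
have finA j : L (A j) < +oo.
  have := mA j; rewrite /A /atom; case: ifPn => [_ _|/set0Pn[i is_] mj].
    by rewrite measure0.
  have [mB LB] := hBs i; apply: le_lt_trans LB; rewrite le_measure ?inE//.
  by move=> z /(_ i I); rewrite is_.
have disjA i j : i != j -> A i `&` A j = set0.
  move=> ij; apply: contrapT => /eqP/set0P[z [Aiz Ajz]].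
  suff : enum_val i = enum_val j by move/enum_val_inj => E; rewrite E eqxx in ij.
  move: Aiz Ajz; rewrite /A /atom; case: ifP => // _ zi; case: ifP => // _ zj.
  apply/setP => l; have := zi l I; have := zj l I.
  by do 2 case: ifP => //.
pose bi (i : 'I_k) : {set 'I_#|{set 'I_k}|} := 
    [set j : 'I_#|{set 'I_k}| | i \in (enum_val j : {set 'I_k})]%SET.
have cupE i : cup A (bi i) = B i.
  apply/seteqP; split => [z [j /=]|z Bz].
    rewrite inE /A /atom; case: ifP => [/eqP -> |_ ij /(_ i I)]; first by rewrite inE.
    by rewrite ij.
  (* The index of the atom containing [z]; it contains [i], so it is not the discarded one. *)
  pose s : {set 'I_k} := [set l | z \in B l]%SET.
  have is_ : i \in s by rewrite inE mem_set.
  exists (enum_rank s) => /=; first by rewrite inE enum_rankK.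
  rewrite /A /atom enum_rankK; case: eqVneq => [s0|_ l _]; first by rewrite s0 inE in is_.
  by rewrite inE; case: ifPn => [/set_mem//|/negP zl zBl]; apply: zl; rewrite mem_set.
have -> : Bs = [seq cup A b | b <- [seq bi i | i <- enum 'I_k]].
  by rewrite -map_comp (eq_map cupE) map_tnth_enum.
exact: integral_tuple_sum_cups.
Qed.

End poisson_tuples.

Local Notation "u `# i" := (nth 0%N u i) (at level 2, format "u `# i").

Section tuple_sum_dsum.
Context {R : realType} {S : Type} (z : nat -> S).
Local Notation I B a := ((\1_B (z a))%:E : \bar R).
Implicit Types A B C D : set S.

Let I0 A a : 0 <= I A a. Proof. by rewrite lee_fin. Qed.

Lemma tuple_sum1 A v : tuple_sum z [:: A] v = dsum 1 v (fun u => I A u`#0).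
Proof. by apply: eq_eseriesr => a _; rewrite mule1. Qed.

Lemma tuple_sum2 A B v :
  tuple_sum z [:: A; B] v = dsum 2 v (fun u => I A u`#1 * I B u`#0).
Proof.
by apply: eq_eseriesr => a _; rewrite [X in _ * X]tuple_sum1 -dsumZl.
Qed.

Lemma tuple_sum3 A B C v : tuple_sum z [:: A; B; C] v
  = dsum 3 v (fun u => I A u`#2 * (I B u`#1 * I C u`#0)).
Proof.
by apply: eq_eseriesr => a _; rewrite [X in _ * X]tuple_sum2 -dsumZl.
Qed.

Lemma tuple_sum4 A B C D v : tuple_sum z [:: A; B; C; D] v
  = dsum 4 v (fun u => I A u`#3 * (I B u`#2 * (I C u`#1 * I D u`#0))).
Proof.
by apply: eq_eseriesr => a _; rewrite [X in _ * X]tuple_sum3 -dsumZl.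
Qed.

End tuple_sum_dsum.

(** * From product sets to nonnegative functions of distinct points *)

Section mecke.
Context d (T : measurableType d) {R : realType} (P : probability T R) (rho : R)
  (X : nat -> T -> R * R).
Hypothesis rho0 : (0 <= rho)%R.
Hypothesis hX : is_PPP P rho X.
Local Notation L := (area R).
Implicit Types A B C D : set (plane R).
Let mX := measurable_point hX.

Let indicX U V (A : set U) (B : set V) p :
  \1_(A `*` B) p = (\1_A p.1 * \1_B p.2)%R :> R.
Proof.
rewrite !indicE; case: (pselect (A p.1)) => [a|a]; case: (pselect (B p.2)) => [b|b].
- by rewrite !mem_set// mulr1.
- by rewrite (mem_set a) !memNset ?mulr0// => -[].
- by rewrite (mem_set b) !memNset ?mul0r// => -[].
- by rewrite !memNset ?mul0r// => -[].
Qed.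

Let P_indic (E : set T) : measurable E -> P E = \int[P]_w (\1_E w)%:E.
Proof. by move=> mE; rewrite integral_indic// setIT. Qed.

Let m2 (u : seq nat) : measurable_fun setT
  (fun w => (X u`#1 w, X u`#0 w) : plane R * plane R)%type.
Proof. by apply: measurable_fun_pair; exact: mX. Qed.

Let m3 (u : seq nat) : measurable_fun setT
  (fun w => (X u`#2 w, X u`#1 w, X u`#0 w) : plane R * plane R * plane R)%type.
Proof.
by apply: measurable_fun_pair; [apply: measurable_fun_pair|]; exact: mX.
Qed.

Let m4 (u : seq nat) : measurable_fun setT
  (fun w => (X u`#3 w, X u`#2 w, X u`#1 w, X u`#0 w)
     : plane R * plane R * plane R * plane R)%type.
Proof.
apply: measurable_fun_pair; last exact: mX.
by apply: measurable_fun_pair; [apply: measurable_fun_pair|]; exact: mX.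
Qed.

(* Both sides of the Mecke formula are measures in [f = 1_S]; on rectangles
   the formula is [integral_tuple_sum]. *)
Section transfer.
Context d' (S : measurableType d') (k : nat) (Z : seq nat -> T -> S)
  (mZ : forall u, measurable_fun setT (Z u)) (c : R) (m : {measure set S -> \bar R}).
Hypothesis c0 : (0 <= c)%R.

Definition tuple_law : {measure set S -> \bar R} :=
  mdsum (fun u => pushm P (mZ u)) k [::].

Lemma tuple_law_int (f : S -> \bar R) :
  (forall E, measurable E -> tuple_law E = c%:E * m E) ->
  measurable_fun setT f -> (forall s, 0 <= f s) ->
  dsum k [::] (fun u => \int[P]_w f (Z u w)) = c%:E * \int[m]_s f s.
Proof.
move=> H mf f0.
transitivity (\int[tuple_law]_s f s).
  rewrite integral_mdsum//; apply: eq_dsum => // u _ _.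
  by rewrite ge0_integral_pushforward.
rewrite (eq_measure_integral (mscale (NngNum c0) m)).
  by rewrite ge0_integral_mscale.
by move=> E mE _; rewrite H.
Qed.

Lemma tuple_lawE E : measurable E ->
  tuple_law E = \int[P]_w dsum k [::] (fun u => (\1_E (Z u w))%:E).
Proof.
move=> mE; rewrite /tuple_law mdsumE integral_dsum//.
- apply: eq_dsum => // u _ _; rewrite /= /pushforward P_indic//.
  by rewrite -[X in measurable X]setTI; exact: mZ.
- move=> u; apply/measurable_EFinP; exact: (measurableT_comp (measurable_indic mE)).
Qed.

End transfer.

Theorem mecke2 (f : plane R * plane R -> \bar R) :
  measurable_fun setT f -> (forall s, 0 <= f s) ->
  dsum 2 [::] (fun u => \int[P]_w f (X u`#1 w, X u`#0 w))
  = (rho ^+ 2)%:E * \int[@area2 R]_s f s.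
Proof.
apply: (@tuple_law_int _ _ 2 _ m2 _ (sfprod L L)); first by rewrite exprn_ge0.
apply: area2_unique; first by rewrite exprn_ge0.
move=> A B [mA fA] [mB fB]; rewrite tuple_lawE; last exact: measurableX.
transitivity (\int[P]_w tuple_sum (X ^~ w) [:: A; B] [::]).
  by apply: eq_integral => w _; rewrite tuple_sum2; apply: eq_dsum => // u _ _;
    rewrite indicX EFinM.
rewrite (integral_tuple_sum rho0 hX); last first.
  by move=> ?; rewrite !inE => /orP[]/eqP ->.
rewrite !big_cons big_nil -(@fineK _ (L A)) ?ge0_fin_numE// -(@fineK _ (L B)) ?ge0_fin_numE//.
by rewrite -!EFinM; congr (_%:E); ring.
Qed.

Theorem mecke3 (f : plane R * plane R * plane R -> \bar R) :
  measurable_fun setT f -> (forall s, 0 <= f s) ->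
  dsum 3 [::] (fun u => \int[P]_w f (X u`#2 w, X u`#1 w, X u`#0 w))
  = (rho ^+ 3)%:E * \int[@area3 R]_s f s.
Proof.
apply: (@tuple_law_int _ _ 3 _ m3 _ (sfprod (sfprod L L) L)); first by rewrite exprn_ge0.
apply: area3_unique; first by rewrite exprn_ge0.
move=> A B C [mA fA] [mB fB] [mC fC]; rewrite tuple_lawE; last first.
  by apply: measurableX => //; apply: measurableX.
transitivity (\int[P]_w tuple_sum (X ^~ w) [:: A; B; C] [::]).
  apply: eq_integral => w _; rewrite tuple_sum3; apply: eq_dsum => // u _ _.
  by rewrite !indicX/= -!EFinM mulrA.
rewrite (integral_tuple_sum rho0 hX); last first.
  by move=> ?; rewrite !inE => /or3P[]/eqP ->.
rewrite !big_cons big_nil -(@fineK _ (L A)) ?ge0_fin_numE// -(@fineK _ (L B)) ?ge0_fin_numE//.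
rewrite -(@fineK _ (L C)) ?ge0_fin_numE//.
by rewrite -!EFinM; congr (_%:E); ring.
Qed.

Theorem mecke4 (f : plane R * plane R * plane R * plane R -> \bar R) :
  measurable_fun setT f -> (forall s, 0 <= f s) ->
  dsum 4 [::] (fun u => \int[P]_w f (X u`#3 w, X u`#2 w, X u`#1 w, X u`#0 w))
  = (rho ^+ 4)%:E * \int[@area4 R]_s f s.
Proof.
apply: (@tuple_law_int _ _ 4 _ m4 _ (sfprod (sfprod (sfprod L L) L) L)); first by rewrite exprn_ge0.
apply: area4_unique; first by rewrite exprn_ge0.
move=> A B C D [mA fA] [mB fB] [mC fC] [mD fD].
rewrite tuple_lawE; last first.
  by do 2 (apply: measurableX => //); apply: measurableX.
transitivity (\int[P]_w tuple_sum (X ^~ w) [:: A; B; C; D] [::]).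
  apply: eq_integral => w _; rewrite tuple_sum4; apply: eq_dsum => // u _ _.
  by rewrite !indicX/= -!EFinM !mulrA.
rewrite (integral_tuple_sum rho0 hX); last first.
  by move=> ?; rewrite !inE => /or4P[]/eqP ->.
rewrite !big_cons big_nil -(@fineK _ (L A)) ?ge0_fin_numE// -(@fineK _ (L B)) ?ge0_fin_numE//.
rewrite -(@fineK _ (L C)) ?ge0_fin_numE// -(@fineK _ (L D)) ?ge0_fin_numE//.
by rewrite -!EFinM; congr (_%:E); ring.
Qed.

End mecke.

(** * Averaging out the uniform labels *)

Section independent_uniform.
Context d (T : measurableType d) {R : realType} (P : probability T R)
  (G : set (set T)) (V : T -> R).
Hypothesis mG : G `<=` measurable.
Hypothesis GI : setI_closed G.
Hypothesis GT : G setT.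
Hypothesis mV : measurable_fun setT V.
Hypothesis indep : forall E B, G E -> measurable B ->
  P (E `&` V @^-1` B) = P E * P (V @^-1` B).
Hypothesis unifV : forall h : R, (0 <= h <= 1)%R -> P [set w | (V w <= h)%R] = h%:E.

Local Notation TG := (g_sigma_algebraType G).

(** The identity as a random element of the coarser sigma-algebra: its law is [P] restricted to the
    sets generated by [G]. *)
Let idG : T -> TG := id.

Let sub_measurable (E : set T) : @measurable _ TG E -> measurable E.
Proof. by apply: smallest_sub => //; exact: sigma_algebra_measurable. Qed.

Let midG : measurable_fun setT idG.
Proof. by move=> _ B mB; rewrite setTI; exact: sub_measurable. Qed.

HB.instance Definition _ := isMeasurableFun.Build _ _ _ _ idG midG.
HB.instance Definition _ := isMeasurableFun.Build _ _ _ _ V mV.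

Let lawG := distribution P idG.
Let lawV := distribution P V.

Let mpair : measurable_fun setT (fun w => (idG w, V w)).
Proof. exact: measurable_fun_pair. Qed.

(** In [E], both sides are finite measures that agree on the pi-system [G]. *)
Let indepG E B : @measurable _ TG E -> measurable B ->
  P (E `&` V @^-1` B) = P E * P (V @^-1` B).
Proof.
move=> mE mB.
have mVB : measurable (V @^-1` B) by rewrite -[X in measurable X]setTI; exact: mV.
have fVB : P (V @^-1` B) \is a fin_num by exact: fin_num_measure.
pose q := NngNum (fine_ge0 (measure_ge0 P (V @^-1` B))).
have qE : q%:num%:E = P (V @^-1` B) by rewrite /= fineK.
rewrite muleC -qE.
apply: (@g_sigma_algebra_measure_unique _ _ _ G mG (fun=> setT) _ _
  (mrestr P mVB) (mscale q P)) => //.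
- by rewrite bigcup_const.
- by move=> A GA; rewrite [LHS]indep// muleC -qE.
- by move=> _; rewrite /= /mrestr setTI -ge0_fin_numE.
Qed.

(** Independence as a product law, so that the label can be integrated with everything else held
    fixed. *)
Let law_pair S : measurable S -> pushm P mpair S = sfprod lawG lawV S.
Proof.
move=> mS; rewrite (@sfprod_unique _ _ _ _ _ lawG lawV 1) ?mul1e//.
move=> A B mA mB _ _; rewrite mul1e; exact: indepG.
Qed.

(* [h] is frozen by the sigma-algebra generated by [G], so [V <= h] may be
   averaged out. *)
Lemma integral_uniform_le (f : T -> \bar R) (h : T -> R) :
  measurable_fun setT (f : TG -> \bar R) -> (forall w, 0 <= f w) ->
  measurable_fun setT (h : TG -> R) -> (forall w, 0 <= h w <= 1)%R ->
  \int[P]_w (f w * ((V w <= h w)%R%:R)%:E) = \int[P]_w (f w * (h w)%:E).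
Proof.
move=> mf f0 mh h01.
pose F (p : TG * R) : \bar R := f p.1 * ((p.2 <= h p.1)%R%:R)%:E.
have mF : measurable_fun setT F.
  apply: emeasurable_funM; first exact: (measurableT_comp mf).
  apply/measurable_EFinP; apply: measurableT_comp => //.
  apply: measurable_fun_ler => //; exact: (measurableT_comp mh).
have F0 p : 0 <= F p by rewrite mule_ge0// lee_fin.
transitivity (\int[pushm P mpair]_p F p).
  by rewrite ge0_integral_pushforward.
rewrite (eq_measure_integral (sfprod lawG lawV)); last by move=> S mS _; exact: law_pair.
rewrite fubini_tonelli1//.
transitivity (\int[lawG]_w (f w * (h w)%:E)).
  apply: eq_integral => w _; rewrite /fubini_F /F/=.
  rewrite ge0_integralZl//.
  - congr (_ * _); rewrite -unifV//.
    transitivity (\int[lawV]_u (\1_[set u | (u <= h w)%R] u)%:E).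
      by apply: eq_integral => u _; rewrite indicE mem_setE.
    rewrite integral_indic ?setIT//.
    have -> : [set u | (u <= h w)%R] = `]-oo, h w]%classic.
      by apply/seteqP; split => u /=; rewrite in_itv.
    exact: measurable_itv.
  - apply/measurable_EFinP; apply: measurableT_comp => //.
    exact: measurable_fun_ler.
rewrite ge0_integral_pushforward//.
  by apply: emeasurable_funM => //; exact/measurable_EFinP.
by move=> w _; rewrite mule_ge0// lee_fin; have /andP[] := h01 w.
Qed.

End independent_uniform.

(** * Averaging the edges of a fixed family of vertices *)

Section random_edges.
Context d (T : measurableType d) {R : realType} (P : probability T R)
  (X : nat -> T -> R * R) (U : nat -> nat -> T -> R).
Hypothesis mX : forall i, measurable_fun setT (X i).
Hypothesis hU : iid_uniform_indep P X U.
Implicit Types (D : set (nat * nat)) (e : nat * nat) (es : seq (nat * nat)).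

Let Uk e w := U e.1 e.2 w.

Let mU e : measurable_fun setT (Uk e).
Proof. by have [+ _] := hU; exact. Qed.

(* Requiring [C k = setT] off [ks] makes this class closed under intersection. *)
Definition cylinders D : set (set T) := [set E | exists sx ks (C : nat * nat -> set R),
  [/\ (forall c, c \in sx -> measurable c.2), uniq ks,
      (forall k, k \in ks -> D k) /\ (forall k, measurable (C k)),
      (forall k, k \notin ks -> C k = setT) &
      E = Xevent X sx `&` [set w | forall k, k \in ks -> C k (Uk k w)]]].

Let Ulist (ks : seq (nat * nat)) (C : nat * nat -> set R) := [seq (k, C k) | k <- ks].

Let Ulist_keys ks C : map fst (Ulist ks C) = ks.
Proof. by rewrite -map_comp map_id. Qed.

Let UlistE ks C : [set w | forall k, k \in ks -> C k (Uk k w)]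
  = \bigcap_(c in [set` Ulist ks C]) Uevent U c.
Proof.
apply/seteqP; split=> w H.
  by move=> _ /= /mapP[k kks ->]; rewrite /Uevent/=; apply: mem_set; exact: H.
by move=> k kks; apply/set_mem; apply: (H (k, C k)) => /=; apply/mapP; exists k.
Qed.

Let measurable_Xevent sx : (forall c, c \in sx -> measurable c.2) ->
  measurable (Xevent X sx).
Proof.
move=> msx.
have -> : Xevent X sx = \bigcap_(c in [set` sx]) (X c.1 @^-1` c.2).
  by apply/seteqP; split=> w H c /H => [/set_mem|?]//; exact: mem_set.
apply: fin_bigcap_measurable => // c csx; rewrite -[Y in measurable Y]setTI.
by apply: mX => //; exact: msx.
Qed.

Let measurable_cylinders D : cylinders D `<=` measurable.
Proof.
move=> _ [sx [ks [C [msx _ [_ mC] _ ->]]]]; apply: measurableI.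
  exact: measurable_Xevent.
rewrite (_ : [set w | _] = \bigcap_(k in [set` ks]) (Uk k @^-1` C k))//.
apply: fin_bigcap_measurable => // k _; rewrite -[Y in measurable Y]setTI.
exact: mU.
Qed.

Let cylindersI D : setI_closed (cylinders D).
Proof.
move=> _ _ [sx [ks [C [msx uks [kD mC] CT ->]]]] [sx' [ks' [C' [msx' uks' [kD' mC'] CT' ->]]]].
exists (sx ++ sx'), (undup (ks ++ ks')), (fun k => C k `&` C' k); split.
- by move=> c; rewrite mem_cat => /orP[/msx|/msx'].
- exact: undup_uniq.
- split=> [k|k]; last exact: measurableI.
  by rewrite mem_undup mem_cat => /orP[/kD|/kD'].
- by move=> k; rewrite mem_undup mem_cat negb_or => /andP[/CT -> /CT' ->]; rewrite setIT.
- apply/seteqP; split=> w.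
    move=> [[wx wu] [wx' wu']]; split.
      by move=> c; rewrite mem_cat => /orP[/wx|/wx'].
    move=> k; rewrite mem_undup mem_cat => kk; split.
      by have [/wu//|/CT ->] := boolP (k \in ks).
    by have [/wu'//|/CT' ->] := boolP (k \in ks').
  move=> [wx wu]; split; split.
  + by move=> c cs; apply: wx; rewrite mem_cat cs.
  + by move=> k kk; apply: (wu k _).1; rewrite mem_undup mem_cat kk.
  + by move=> c cs; apply: wx; rewrite mem_cat cs orbT.
  + by move=> k kk; apply: (wu k _).2; rewrite mem_undup mem_cat kk orbT.
Qed.

Let cylindersT D : cylinders D setT.
Proof.
exists [::], [::], (fun=> setT); split => //.
by apply/seteqP; split => // w _; split.
Qed.

(** The independence hypothesis is applied with and without the label [e]; adjoining [e] keeps the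
    keys distinct because the others all lie in [D]. *)
Let cylinders_indep D e E B : ~ D e -> cylinders D E -> measurable B ->
  P (E `&` Uk e @^-1` B) = P E * P (Uk e @^-1` B).
Proof.
move=> nDe [sx [ks [C [msx uks [kD mC] _ ->]]]] mB.
have [_ [_ indep]] := hU.
have UeE : Uk e @^-1` B = Uevent U (e, B).
  by apply/seteqP; split=> w; [exact: mem_set|exact: set_mem].
have H := indep sx (Ulist ks C) msx; have H' := indep sx ((e, B) :: Ulist ks C) msx.
rewrite UlistE H; last 2 first.
- by move=> _ /mapP[k _ ->]; exact: mC.
- by rewrite Ulist_keys.
rewrite UeE -setIA [X in _ `&` X]setIC.
rewrite (_ : Uevent U (e, B) `&` _ =
    \bigcap_(c in [set` (e, B) :: Ulist ks C]) Uevent U c); last first.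
  apply/seteqP; split=> w.
    by move=> [w1 w2] c /=; rewrite inE => /orP[/eqP -> //|]; exact: w2.
  move=> H0; split; first by apply: (H0 (e, B)); rewrite /= mem_head.
  by move=> c /= cu; apply: H0; rewrite /= inE cu orbT.
rewrite H'; first by rewrite big_cons muleCA muleC.
- by move=> c; rewrite inE => /orP[/eqP -> //|/mapP[k _ ->]]; exact: mC.
- by rewrite /= Ulist_keys uks andbT; apply/negP => /kD.
Qed.

Let unif_le e (h : R) : (0 <= h <= 1)%R -> P [set w | (Uk e w <= h)%R] = h%:E.
Proof.
move=> /andP[h0 h1]; have [_ [unif _]] := hU.
transitivity (P [set w | U e.1 e.2 w \in `]-oo, h]%classic]).
  by congr (P _); apply/seteqP; split => w /=; rewrite inE/= in_itv.
rewrite unif//.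
have -> : `]-oo, h]%classic `&` `[0%R, 1%R]%classic = `[0%R, h]%classic.
  apply/seteqP; split => u /=; rewrite !in_itv/=.
    by move=> [-> /andP[->]].
  by move=> /andP[-> uh]; rewrite uh (le_trans uh).
by rewrite lebesgue_measure_itv/= lte_fin; case: ltP => [_|h00]; rewrite ?oppr0 ?adde0//
  (@le_anti _ _ h 0%R) ?h00.
Qed.

Local Notation TD D := (g_sigma_algebraType (cylinders D)).

Lemma measurable_cylinders_X D i : measurable_fun setT (X i : TD D -> R * R).
Proof.
move=> _ B mB; rewrite setTI; apply: sub_gen_smallest.
exists [:: (i, B)], [::], (fun=> setT); split => //.
  by move=> c; rewrite mem_seq1 => /eqP ->.
apply/seteqP; split=> [w wB|w [/(_ (i, B)) wB _]].
  by split => // c; rewrite mem_seq1 => /eqP -> /=; exact: mem_set.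
by apply/set_mem; apply: wB; rewrite mem_seq1.
Qed.

Lemma measurable_cylinders_U D e : D e -> measurable_fun setT (Uk e : TD D -> R).
Proof.
move=> De _ B mB; rewrite setTI; apply: sub_gen_smallest.
exists [::], [:: e], (fun k => if k == e then B else setT); split => //.
- by split=> [k|k]; [rewrite inE => /eqP ->|case: ifP].
- by move=> k; rewrite inE => /negbTE ->.
- apply/seteqP; split=> [w wB|w [_ /(_ e)]].
    by split => // k; rewrite inE => /eqP ->; rewrite eqxx.
  by rewrite inE eqxx; exact.
Qed.

Section edges.
Variable h : nat * nat -> T -> R.
Hypothesis mh : forall D e, measurable_fun setT (h e : TD D -> R).
Hypothesis h01 : forall e w, (0 <= h e w <= 1)%R.

Lemma integral_edges (g : T -> \bar R) es : uniq es ->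
  (forall D, measurable_fun setT (g : TD D -> \bar R)) -> (forall w, 0 <= g w) ->
  \int[P]_w (g w * (\prod_(e <- es) (Uk e w <= h e w)%R%:R)%:E)
  = \int[P]_w (g w * (\prod_(e <- es) h e w)%:E).
Proof.
elim: es g => [|e es IH] g /=.
  by move=> *; apply: eq_integral => w _; rewrite !big_nil.
move=> /andP[ees ues] mg g0.
pose f w := g w * (\prod_(e <- es) (Uk e w <= h e w)%R%:R)%:E.
transitivity (\int[P]_w (f w * ((Uk e w <= h e w)%R%:R)%:E)).
  by apply: eq_integral => w _; rewrite big_cons EFinM muleCA muleC.
(* All points and all labels other than that of [e] are frozen; as [es] has no repetition, the
   remaining indicators read only those. *)
rewrite (@integral_uniform_le _ _ _ P (cylinders [set k | k != e]) (Uk e))//.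
- transitivity (\int[P]_w ((g w * (h e w)%:E)
      * (\prod_(e <- es) (Uk e w <= h e w)%R%:R)%:E)).
    by apply: eq_integral => w _; rewrite /f muleAC.
  rewrite IH//.
  + by apply: eq_integral => w _; rewrite big_cons EFinM muleA.
  + by move=> D; apply: emeasurable_funM => //; exact/measurable_EFinP.
  + by move=> w; rewrite mule_ge0// lee_fin; have /andP[] := h01 e w.
- by move=> E B GE mB; apply: cylinders_indep GE mB => /=; rewrite eqxx.
- exact: unif_le.
- apply: emeasurable_funM; first exact: mg.
  apply/measurable_EFinP; apply: measurable_prod => k kes.
  apply: measurableT_comp => //; apply: measurable_fun_ler; last exact: mh.
  by apply: measurable_cylinders_U => /=; apply: contraNneq ees => <-.
- by move=> w; rewrite /f mule_ge0// lee_fin prodr_ge0.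
Qed.

End edges.
End random_edges.

(** * Integrals of kernel products *)

Section kernel_products.
Context {R : realType} (beta : R) (x y : plane R).
Hypothesis beta0 : (0 < beta)%R.
Local Notation L := (area R).
Local Notation K := (kern beta).
Local Notation K2 := (kern2 beta).
Local Notation D2 := (sqdist x y).
Let plane2 := (plane R * plane R)%type.
Let plane3 := (plane R * plane R * plane R)%type.

Ltac mkern := repeat first
  [ exact: measurable_fst | exact: measurable_snd | exact: measurable_cst
  | exact: measurable_id
  | lazymatch goal with
    | |- measurable_fun _ (fun p => fst (@?f p)) =>
        apply: (measurableT_comp (f := fst)); [exact: measurable_fst|]
    | |- measurable_fun _ (fun p => snd (@?f p)) =>
        apply: (measurableT_comp (f := snd)); [exact: measurable_snd|]
    | |- measurable_fun _ (fun p => kern _ _ _) => apply: measurable_kern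
    | |- measurable_fun _ (kern _ _) => apply: measurable_kern
    | |- measurable_fun _ (fun p => kern2 _ _ _) => apply: measurable_kern2
    | |- measurable_fun _ (kern2 _ _) => apply: measurable_kern2
    | |- measurable_fun _ (fun p => (_ * _)%R) => apply: measurable_funM
    | |- measurable_fun _ (fun p => _%:E) => apply/measurable_EFinP
    end ].

Let k0 p q : (0 <= K p q)%R. Proof. exact: kern_ge0. Qed.
Let kk0 p q : (0 <= K2 p q)%R. Proof. exact: kern2_ge0. Qed.

Definition path3 (a b : plane R) : R := (K x a * K a b * K b y)%R.

Lemma path3_ge0 a b : (0 <= path3 a b)%R.
Proof. by rewrite !mulr_ge0. Qed.

Ltac pge0 :=
  repeat first [exact: path3_ge0 | exact: k0 | exact: kk0 | apply: mulr_ge0].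

Definition path3_int : R := (pi ^+ 2 / (3 * beta ^+ 2) * expR (- (beta * D2 / 3)))%R.

Lemma measurable_path3 d (S : measurableType d) (f g : S -> plane R) :
  measurable_fun setT f -> measurable_fun setT g ->
  measurable_fun setT (fun s => path3 (f s) (g s)).
Proof.
by move=> mf mg; apply: measurable_funM; [apply: measurable_funM|]; apply: measurable_kern.
Qed.

(** Integrating out a vertex of degree two replaces its two edges by [kern2]; repeated use leaves
    one of the one-point integrals above in every pattern but the diamond. *)
Lemma integral_step a q (c : R) : (0 <= c)%R ->
  \int[L]_b (c * (K a b * K b q))%:E = (c * K2 a q)%:E.
Proof.
move=> c0; under eq_integral do rewrite EFinM.
rewrite ge0_integralZl//.
- by rewrite integral_kern2.
- by mkern.
- by move=> b _; rewrite lee_fin mulr_ge0.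
Qed.

Lemma area2_path3 : \int[@area2 R]_p (path3 p.1 p.2)%:E = path3_int%:E.
Proof.
rewrite /area2 /sfprod fubini_tonelli1//=; last 2 first.
- by apply/measurable_EFinP; apply: measurable_path3; mkern.
- by move=> p; rewrite lee_fin path3_ge0.
rewrite -integral_path3//; apply: eq_integral => a _; rewrite /fubini_F/=.
by under eq_integral do rewrite /path3 -mulrA; exact: integral_step.
Qed.

Lemma area2_diamond :
  \int[@area2 R]_p (path3 p.1 p.2 * (K x p.2 * K p.1 y))%:E
  = (pi ^+ 2 / (8 * beta ^+ 2) * expR (- (beta * D2)))%:E.
Proof.
rewrite /area2 /sfprod fubini_tonelli1//=; last 2 first.
- by apply/measurable_EFinP; apply: measurable_funM; [apply: measurable_path3|]; mkern.
- by move=> p; rewrite lee_fin; pge0.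
by rewrite -integral_diamond.
Qed.

Lemma area3_tonelli (f : plane3 -> R) (g : plane2 -> R) :
  measurable_fun setT f -> (forall p, 0 <= f p)%R ->
  (forall p, \int[L]_c (f (p, c))%:E = (g p)%:E) ->
  \int[@area3 R]_p (f p)%:E = \int[@area2 R]_p (g p)%:E.
Proof.
move=> mf f0 fg; rewrite /area3 [X in \int[X]_p _]/sfprod fubini_tonelli1//=; last first.
- exact/measurable_EFinP.
by apply: eq_integral => p _; rewrite /fubini_F fg.
Qed.

(** Paths through (a, b) and (a, c): the common edge from [x] to [a] occurs once, and [b] and [c]
    each give a factor [kern2 a y]. *)
Lemma area3_fork1 :
  \int[@area3 R]_p (path3 p.1.1 p.1.2 * (K p.1.1 p.2 * K p.2 y))%:E
  = (pi ^+ 3 / (8 * beta ^+ 3) * expR (- (beta * D2 / 2)))%:E.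
Proof.
rewrite (@area3_tonelli _ (fun p => path3 p.1 p.2 * K2 p.1 y)%R); last 3 first.
- by apply: measurable_funM; [apply: measurable_path3|]; mkern.
- by move=> p; pge0.
- by move=> p; exact: integral_step (path3_ge0 _ _).
rewrite /area2 /sfprod fubini_tonelli1//=; last 2 first.
- by apply/measurable_EFinP; apply: measurable_funM; [apply: measurable_path3|]; mkern.
- by move=> p; rewrite lee_fin; pge0.
rewrite -integral_fork//; apply: eq_integral => a _; rewrite /fubini_F/=.
transitivity (\int[L]_b ((K x a * K2 a y) * (K a b * K b y))%:E).
  by apply: eq_integral => b _; rewrite /path3; congr (_%:E); ring.
by rewrite integral_step; [rewrite mulrA|pge0].
Qed.

(** The mirror image, with [b] as common last vertex; the first coordinate is therefore integrated
    before the second. *)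
Lemma area3_fork2 :
  \int[@area3 R]_p (path3 p.1.1 p.1.2 * (K x p.2 * K p.2 p.1.2))%:E
  = (pi ^+ 3 / (8 * beta ^+ 3) * expR (- (beta * D2 / 2)))%:E.
Proof.
rewrite (@area3_tonelli _ (fun p => path3 p.1 p.2 * K2 x p.2)%R); last 3 first.
- by apply: measurable_funM; [apply: measurable_path3|]; mkern.
- by move=> p; pge0.
- by move=> p; exact: integral_step (path3_ge0 _ _).
rewrite /area2 /sfprod fubini_tonelli2//=; last 2 first.
- by apply/measurable_EFinP; apply: measurable_funM; [apply: measurable_path3|]; mkern.
- by move=> p; rewrite lee_fin; pge0.
rewrite (sqdistC x) -integral_fork//; apply: eq_integral => b _; rewrite /fubini_G/=.
transitivity (\int[L]_a ((K b y * K2 x b) * (K x a * K a b))%:E).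
  by apply: eq_integral => a _; rewrite /path3; congr (_%:E); ring.
by rewrite integral_step; [rewrite kernC -mulrA (kern2C beta x)|pge0].
Qed.

(** Paths through (a, b) and (b, c): [b] is next to [y] in one and next to [x] in the other, so it
    keeps an edge to both ends while [a] and [c] are integrated out. *)
Lemma area3_middle1 :
  \int[@area3 R]_p (path3 p.1.1 p.1.2 * path3 p.1.2 p.2)%:E
  = (pi ^+ 3 / (12 * beta ^+ 3) * expR (- (3 * beta * D2 / 4)))%:E.
Proof.
rewrite (@area3_tonelli _ (fun p => path3 p.1 p.2 * K x p.2 * K2 p.2 y)%R); last 3 first.
- by apply: measurable_funM; apply: measurable_path3; mkern.
- by move=> p; rewrite mulr_ge0// path3_ge0.
- move=> p; rewrite -integral_step; [|by pge0].
  by apply: eq_integral => c _; rewrite /= [path3 p.2 _]/path3; congr (_%:E); ring.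
rewrite /area2 /sfprod fubini_tonelli2//=; last 2 first.
- apply/measurable_EFinP; apply: measurable_funM; last by mkern.
  by apply: measurable_funM; [apply: measurable_path3|]; mkern.
- by move=> p; rewrite lee_fin; pge0.
rewrite -integral_middle//; apply: eq_integral => b _; rewrite /fubini_G/=.
transitivity (\int[L]_a ((K x b * K b y * K2 b y) * (K x a * K a b))%:E).
  by apply: eq_integral => a _; rewrite /path3; congr (_%:E); ring.
by rewrite integral_step; [congr (_%:E); ring|pge0].
Qed.

(** Paths through (a, b) and (c, a): the same pattern with [a] as the shared vertex. *)
Lemma area3_middle2 :
  \int[@area3 R]_p (path3 p.1.1 p.1.2 * path3 p.2 p.1.1)%:E
  = (pi ^+ 3 / (12 * beta ^+ 3) * expR (- (3 * beta * D2 / 4)))%:E.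
Proof.
rewrite (@area3_tonelli _ (fun p => path3 p.1 p.2 * K p.1 y * K2 x p.1)%R); last 3 first.
- by apply: measurable_funM; apply: measurable_path3; mkern.
- by move=> p; rewrite mulr_ge0// path3_ge0.
- move=> p; rewrite -integral_step; [|by pge0].
  by apply: eq_integral => c _; rewrite /= [path3 _ p.1]/path3; congr (_%:E); ring.
rewrite /area2 /sfprod fubini_tonelli1//=; last 2 first.
- apply/measurable_EFinP; apply: measurable_funM; last by mkern.
  by apply: measurable_funM; [apply: measurable_path3|]; mkern.
- by move=> p; rewrite lee_fin; pge0.
rewrite -integral_middle//; apply: eq_integral => a _; rewrite /fubini_F/=.
transitivity (\int[L]_b ((K x a * K a y * K2 x a) * (K a b * K b y))%:E).
  by apply: eq_integral => b _; rewrite /path3; congr (_%:E); ring.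
by rewrite integral_step; [congr (_%:E); ring|pge0].
Qed.

Lemma path3_int_ge0 : (0 <= path3_int)%R.
Proof.
rewrite -lee_fin -area2_path3; apply: integral_ge0 => p _.
by rewrite lee_fin path3_ge0.
Qed.

Lemma area4_path3 :
  \int[@area4 R]_p (path3 p.1.1.1 p.1.1.2 * path3 p.1.2 p.2)%:E
  = (path3_int * path3_int)%:E.
Proof.
rewrite /area4 [X in \int[X]_p _]/sfprod fubini_tonelli1//=; last 2 first.
- by apply/measurable_EFinP; apply: measurable_funM; apply: measurable_path3; mkern.
- by move=> p; rewrite lee_fin mulr_ge0// path3_ge0.
transitivity (\int[@area3 R]_p (path3 p.1.1 p.1.2 * (K x p.2 * K2 p.2 y))%:E).
  apply: eq_integral => p _; rewrite /fubini_F/=.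
  rewrite mulrA -integral_step ; [|by pge0].
  by apply: eq_integral => c _; rewrite [path3 p.2 _]/path3; congr (_%:E); ring.
rewrite (@area3_tonelli _ (fun p => path3 p.1 p.2 * path3_int)%R); last 3 first.
- by apply: measurable_funM; [apply: measurable_path3|]; mkern.
- by move=> p; pge0.
- move=> p.
  transitivity (\int[L]_c ((path3 p.1 p.2)%:E * (K x c * K2 c y)%:E)).
    by apply: eq_integral => c _; rewrite -EFinM.
  rewrite ge0_integralZl//.
  + by rewrite integral_path3.
  + by mkern.
  + by move=> c _; rewrite lee_fin mulr_ge0.
  + by rewrite lee_fin path3_ge0.
under eq_integral do rewrite EFinM.
rewrite ge0_integralZr//.
- by rewrite area2_path3.
- by apply/measurable_EFinP; apply: measurable_path3; mkern.
- by move=> p _; rewrite lee_fin path3_ge0.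
- by rewrite lee_fin path3_int_ge0.
Qed.

End kernel_products.

(** * The second moment *)

Section square_of_distinct_sum.
Context {R : realType} (phi : nat -> nat -> R).
Hypothesis phi0 : forall a b, (0 <= phi a b)%R.
Implicit Types (g : nat -> \bar R).

Lemma series_notinD1 g (v : seq nat) a : (forall c, 0 <= g c) -> a \notin v ->
  \sum_(c <oo | c \notin v) g c = g a + \sum_(c <oo | c \notin a :: v) g c.
Proof.
move=> g0 av; rewrite (@nneseriesD1 _ _ a)//; congr (_ + _).
by apply: eq_eseriesl => c; rewrite inE negb_or andbC.
Qed.

Lemma eq_series_notin g (v v' : seq nat) : v =i v' ->
  \sum_(c <oo | c \notin v) g c = \sum_(c <oo | c \notin v') g c.
Proof. by move=> vv'; apply: eq_eseriesl => c; rewrite vv'. Qed.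

Let F0 a b : 0 <= (phi a b)%:E. Proof. by rewrite lee_fin. Qed.
Let S := dsum 2 [::] (fun u => (phi u`#1 u`#0)%:E).
Let s1_ge0 (P : pred nat) g : (forall c, 0 <= g c) -> 0 <= \sum_(c <oo | P c) g c.
Proof. by move=> g0; apply: nneseries_ge0. Qed.

(** All ordered pairs are sorted by where [a] and [b] occur in them. The excluded list is
    [[:: b; a]], the state of [dsum] after choosing [a] and then [b], so the remaining sums can be
    glued to an outer sum by [dsum_add]. *)
Lemma dsum2_split a b : a != b -> S = (phi a b)%:E + ((phi b a)%:E
  + (dsum 1 [:: b; a] (fun u => (phi u`#2 u`#0)%:E)
  + (dsum 1 [:: b; a] (fun u => (phi u`#1 u`#0)%:E)
  + (dsum 1 [:: b; a] (fun u => (phi u`#0 u`#2)%:E)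
  + (dsum 1 [:: b; a] (fun u => (phi u`#0 u`#1)%:E)
  + dsum 2 [:: b; a] (fun u => (phi u`#1 u`#0)%:E)))))).
Proof.
move=> ab.
pose g c := \sum_(d <oo | d \notin [:: c]) (phi c d)%:E.
have g0 c : 0 <= g c by exact: s1_ge0.
rewrite -[LHS]/(\sum_(c <oo | c \notin [::]) g c).
rewrite (@series_notinD1 g [::] a)// (@series_notinD1 g [:: a] b)//; last first.
  by rewrite inE eq_sym.
have -> : g a = (phi a b)%:E + \sum_(d <oo | d \notin [:: b; a]) (phi a d)%:E.
  by rewrite /g (@series_notinD1 _ _ b)// inE eq_sym.
have -> : g b = (phi b a)%:E + \sum_(d <oo | d \notin [:: b; a]) (phi b d)%:E.
  rewrite /g (@series_notinD1 _ _ a)//; last by rewrite inE.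
  by congr (_ + _); apply: eq_series_notin => c; rewrite !inE orbC.
have -> : \sum_(c <oo | c \notin [:: b; a]) g c
    = \sum_(c <oo | c \notin [:: b; a]) ((phi c a)%:E + ((phi c b)%:E +
        \sum_(d <oo | d \notin [:: c; b; a]) (phi c d)%:E)).
  apply: eq_eseriesr => c; rewrite !inE negb_or => /andP[cb ca].
  rewrite /g (@series_notinD1 _ _ a)//; last by rewrite inE eq_sym.
  rewrite (@series_notinD1 _ _ b)//; last by rewrite !inE negb_or !(eq_sym b) ab.
  by congr (_ + (_ + _)); apply: eq_series_notin => d; rewrite !inE orbA orbC.
rewrite nneseriesD//; last by move=> c _ _; rewrite adde_ge0// s1_ge0.
rewrite nneseriesD//; last by move=> c _ _; exact: s1_ge0.
rewrite -!addeA; congr (_ + _); rewrite addeCA; congr (_ + _).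
Qed.

Lemma dsum2_square (s : R) : S = s%:E -> (s * s)%:E =
  dsum 2 [::] (fun u => (phi u`#1 u`#0 * phi u`#1 u`#0)%:E)
  + (dsum 2 [::] (fun u => (phi u`#1 u`#0 * phi u`#0 u`#1)%:E)
  + (dsum 3 [::] (fun u => (phi u`#2 u`#1 * phi u`#2 u`#0)%:E)
  + (dsum 3 [::] (fun u => (phi u`#2 u`#1 * phi u`#1 u`#0)%:E)
  + (dsum 3 [::] (fun u => (phi u`#2 u`#1 * phi u`#0 u`#2)%:E)
  + (dsum 3 [::] (fun u => (phi u`#2 u`#1 * phi u`#0 u`#1)%:E)
  + dsum 4 [::] (fun u => (phi u`#3 u`#2 * phi u`#1 u`#0)%:E)))))).
Proof.
(* One factor is opened as a sum over pairs while the other stays the finite constant [s]; inside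
   each term that constant is expanded relative to the current pair. *)
move=> Ss; rewrite EFinM -[X in _ * X]Ss -dsumZl//.
rewrite (_ : 4%N = (2 + 2)%N)// (_ : 3%N = (2 + 1)%N)// !dsum_add.
have G0 (f : nat -> nat -> nat -> nat -> R) k u : 
    (forall a b c d, 0 <= f a b c d)%R ->
    0 <= dsum k u (fun u => (f u`#3 u`#2 u`#1 u`#0)%:E).
  by move=> f0; apply: dsum_ge0 => v; rewrite lee_fin.
have P0 a b c d : (0 <= phi a b * phi c d)%R by rewrite mulr_ge0.
have E0 a b c d : 0 <= (phi a b * phi c d)%:E by rewrite lee_fin.
rewrite -!dsumD//; try by move=> u; repeat first [exact: E0|apply: adde_ge0|apply: dsum_ge0 => ?].
apply: eq_dsum => // u uu su; case: u su uu => [//|b [//|a [|//]]] _.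
rewrite /= inE andbT => ba.
rewrite -Ss (@dsum2_split a b) 1?eq_sym// muleC.
rewrite !ge0_muleDr//; try by repeat first [exact: F0|apply: adde_ge0|apply: dsum_ge0 => ?].
rewrite -!dsumZl//; try by move=> ?.
Qed.

End square_of_distinct_sum.

Section path_keys.
Implicit Types a b c : nat.

(** The label of an edge must not depend on the direction of travel; this is what makes reversed
    paths share their middle edge. *)
Definition key a b := (minn a.+2 b.+2, maxn a.+2 b.+2).

Lemma keyC a b : key a b = key b a.
Proof. by rewrite /key minnC maxnC. Qed.

Lemma key_eq a b c d :
  (key a b == key c d) = ((a == c) && (b == d)) || ((a == d) && (b == c)).
Proof. by rewrite xpair_eqE; lia. Qed.

Lemma key_neq0 a b c : ((0%N, a) == key b c) = false.
Proof. by rewrite xpair_eqE; lia. Qed.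

Lemma key_neq1 a b c : ((1%N, a) == key b c) = false.
Proof. by rewrite xpair_eqE; lia. Qed.

(* Vertex 0 is x, vertex 1 is y and vertex [a.+2] is [X a]. *)
Definition path_keys a b : seq (nat * nat) := [:: (0%N, a.+2); key a b; (1%N, b.+2)].

End path_keys.

Ltac ukeys := rewrite /= !inE ?negb_or ?(eq_sym (key _ _) (0%N, _))
  ?(eq_sym (key _ _) (1%N, _)) ?key_eq ?key_neq0 ?key_neq1 ?xpair_eqE ?eqSS; lia.

(** * Moments of the number of three-hop paths *)

Section three_hop_paths.
Context d (T : measurableType d) {R : realType} (P : probability T R) (rho beta : R)
  (x y : R * R) (X : nat -> T -> R * R) (U : nat -> nat -> T -> R).
Hypothesis rho0 : (0 < rho)%R.
Hypothesis beta0 : (0 < beta)%R.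
Hypothesis hX : is_PPP P rho X.
Hypothesis hU : iid_uniform_indep P X U.
Local Notation K := (kern beta).

Let mX i : measurable_fun setT (X i). Proof. by have [+ _] := hX; exact. Qed.

Definition econn (e : nat * nat) (w : T) : R :=
  K (vpt x y X e.1 w) (vpt x y X e.2 w).

Definition elab (w : T) (e : nat * nat) : bool := (U e.1 e.2 w <= econn e w)%R.

Definition hop a b w : R := (all (elab w) (path_keys a b))%:R.

Lemma econn_key a b w : econn (key a b) w = K (X a w) (X b w).
Proof.
by rewrite /econn /key; case: (leqP a.+2 b.+2) => _ //; exact: kernC.
Qed.

Lemma rcm_pathE a b w : a != b ->
  (rcm_edge beta x y X U 0 a.+2 w && rcm_edge beta x y X U a.+2 b.+2 w
    && rcm_edge beta x y X U b.+2 1 w) = all (elab w) (path_keys a b).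
Proof.
move=> ab; rewrite /= andbT andbA; congr (_ && _ && _).
- by rewrite /elab econn_key /rcm_edge eqSS eqSS ab.
- rewrite /rcm_edge /elab /econn/= kernC/=.
  by rewrite (_ : minn b.+2 1 = 1%N) 1?(_ : maxn b.+2 1 = b.+2)//; lia.
Qed.

Lemma hop_ge0 a b w : (0 <= hop a b w)%R. Proof. by rewrite /hop. Qed.

(** The count before [fine], to be integrated before it is known to be finite. *)
Definition paths w : \bar R := dsum 2 [::] (fun u => (hop u`#1 u`#0 w)%:E).

Lemma sigma3E w : sigma3 beta x y X U w = fine (paths w).
Proof.
rewrite /sigma3 /paths/=; congr (fine _); apply: eq_eseriesr => a _.
rewrite [RHS]eseries_mkcond; apply: eq_eseriesr => b _; rewrite inE (eq_sym b).
by case: (eqVneq a b) => [//|ab]; rewrite /hop -rcm_pathE.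
Qed.

Let mvpt D i : measurable_fun setT
  (vpt x y X i : g_sigma_algebraType (cylinders X U D) -> plane R).
Proof.
case: i => [|[|i]]; [exact: measurable_cst|exact: measurable_cst|].
exact: (@measurable_cylinders_X _ _ _ X U D i).
Qed.

Let mvptT i : measurable_fun setT (vpt x y X i : T -> plane R).
Proof. by case: i => [|[|i]]; [exact: measurable_cst|exact: measurable_cst|exact: mX]. Qed.

Let mU e : measurable_fun setT (U e.1 e.2).
Proof. by have [+ _] := hU; exact. Qed.

Lemma measurable_hop a b : measurable_fun setT (hop a b).
Proof.
have melab e : measurable_fun setT (elab ^~ e).
  by apply: measurable_fun_ler => //; apply: measurable_kern; exact: mvptT.
apply: measurableT_comp => //=.
by apply: measurable_and => //; apply: measurable_and => //; apply: measurable_and.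
Qed.

(** An edge used by both paths contributes its probability once, its indicator being idempotent; so
    [es] lists the union of the two edge sets without repetition. *)
Lemma integral_hops a b a' b' es : uniq es -> es =i path_keys a b ++ path_keys a' b' ->
  \int[P]_w (hop a b w * hop a' b' w)%:E = \int[P]_w (\prod_(e <- es) econn e w)%:E.
Proof.
move=> ues eses.
transitivity (\int[P]_w (1 * (\prod_(e <- es) (elab w e)%:R)%R%:E)).
  apply: eq_integral => w _; rewrite mul1e; congr (_%:E).
  rewrite /hop -natrM mulnb -all_cat -(eq_all_r eses).
  elim: es {ues eses} => [|e es IH] /=; first by rewrite big_nil.
  by rewrite big_cons -IH -natrM mulnb.
rewrite (integral_edges mX hU (h := econn))//.
- by apply: eq_integral => w _; rewrite mul1e.
- by move=> D e; apply: measurable_kern; exact: mvpt.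
- by move=> e w; rewrite kern_ge0 kern_le1.
Qed.

Local Notation f3 := (path3 beta x y).
Local Notation I3 := (path3_int beta x y).

Lemma econn0 a w : econn (0%N, a.+2) w = K x (X a w). Proof. by []. Qed.
Lemma econn1 a w : econn (1%N, a.+2) w = K (X a w) y. Proof. by rewrite kernC. Qed.

Ltac econ := apply: eq_integral => w _; congr (_%:E);
  rewrite !big_cons big_nil !econn0 !econn1 !econn_key /path3 /=.

Lemma hops_same : dsum 2 [::] (fun u => \int[P]_w (hop u`#1 u`#0 w * hop u`#1 u`#0 w)%:E)
  = (rho ^+ 2)%:E * I3%:E.
Proof.
rewrite -area2_path3// -(mecke2 (ltW rho0) hX (f := fun p => (f3 p.1 p.2)%:E)).
- apply: eq_dsum => // -[//|b [//|a [|//]]] /=; rewrite inE andbT => ba _.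
  rewrite (@integral_hops a b a b (path_keys a b)).
  + by econ; ring.
  + by ukeys.
  + by move=> e; rewrite mem_cat orbb.
- by apply/measurable_EFinP; apply: measurable_path3.
- by move=> p; rewrite lee_fin path3_ge0.
Qed.

(** Reversing the pair keeps the middle edge and adds two new ones: five labels in all. *)
Lemma hops_rev : dsum 2 [::] (fun u => \int[P]_w (hop u`#1 u`#0 w * hop u`#0 u`#1 w)%:E)
  = (rho ^+ 2 * (pi ^+ 2 / (8 * beta ^+ 2) * expR (- (beta * sqdist x y))))%:E.
Proof.
rewrite EFinM -area2_diamond//.
rewrite -(mecke2 (ltW rho0) hX (f := fun p => (f3 p.1 p.2 * (K x p.2 * K p.1 y))%:E)).
- apply: eq_dsum => // -[//|b [//|a [|//]]] /=; rewrite inE andbT => ba _.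
  rewrite (@integral_hops a b b a (path_keys a b ++ [:: (0%N, b.+2); (1%N, a.+2)])).
  + by econ; ring.
  + by ukeys.
  + move=> e; rewrite !mem_cat !inE (keyC b a).
    by do ! case: (e == _) => //.
- apply/measurable_EFinP; apply: measurable_funM; first exact: measurable_path3.
  by apply: measurable_funM; apply: measurable_kern.
- by move=> p; rewrite lee_fin !mulr_ge0 ?path3_ge0 ?kern_ge0.
Qed.

(** The paths share the edge from [x] to their common first vertex, which leaves five labels. *)
Lemma hops_fork1 :
  dsum 3 [::] (fun u => \int[P]_w (hop u`#2 u`#1 w * hop u`#2 u`#0 w)%:E)
  = (rho ^+ 3 * (pi ^+ 3 / (8 * beta ^+ 3) * expR (- (beta * sqdist x y / 2))))%:E.
Proof.
rewrite EFinM -area3_fork1//.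
rewrite -(mecke3 (ltW rho0) hX
  (f := fun p => (f3 p.1.1 p.1.2 * (K p.1.1 p.2 * K p.2 y))%:E)).
- apply: eq_dsum => // -[//|c [//|b [//|a [|//]]]] /=.
  rewrite !inE !negb_or !andbT => /andP[/andP[cb ca] ba] _.
  rewrite (@integral_hops a b a c (path_keys a b ++ [:: key a c; (1%N, c.+2)])).
  + by econ; ring.
  + by ukeys.
  + by move=> e; rewrite !mem_cat !inE; do ! case: (e == _) => //.
- apply/measurable_EFinP; apply: measurable_funM.
    by apply: measurable_path3; apply: measurableT_comp.
  by apply: measurable_funM; apply: measurable_kern => //; apply: measurableT_comp.
- by move=> p; rewrite lee_fin !mulr_ge0 ?path3_ge0 ?kern_ge0.
Qed.

Lemma hops_fork2 :
  dsum 3 [::] (fun u => \int[P]_w (hop u`#2 u`#1 w * hop u`#0 u`#1 w)%:E)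
  = (rho ^+ 3 * (pi ^+ 3 / (8 * beta ^+ 3) * expR (- (beta * sqdist x y / 2))))%:E.
Proof.
rewrite EFinM -area3_fork2//.
rewrite -(mecke3 (ltW rho0) hX
  (f := fun p => (f3 p.1.1 p.1.2 * (K x p.2 * K p.2 p.1.2))%:E)).
- apply: eq_dsum => // -[//|c [//|b [//|a [|//]]]] /=.
  rewrite !inE !negb_or !andbT => /andP[/andP[cb ca] ba] _.
  rewrite (@integral_hops a b c b (path_keys a b ++ [:: (0%N, c.+2); key c b])).
  + by econ; ring.
  + by ukeys.
  + by move=> e; rewrite !mem_cat !inE; do ! case: (e == _) => //.
- apply/measurable_EFinP; apply: measurable_funM.
    by apply: measurable_path3; apply: measurableT_comp.
  by apply: measurable_funM; apply: measurable_kern => //; apply: measurableT_comp.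
- by move=> p; rewrite lee_fin !mulr_ge0 ?path3_ge0 ?kern_ge0.
Qed.

(** The common vertex has different positions in the two paths, so no edge is shared and all six
    labels are distinct. *)
Lemma hops_middle1 :
  dsum 3 [::] (fun u => \int[P]_w (hop u`#2 u`#1 w * hop u`#1 u`#0 w)%:E)
  = (rho ^+ 3 * (pi ^+ 3 / (12 * beta ^+ 3) * expR (- (3 * beta * sqdist x y / 4))))%:E.
Proof.
rewrite EFinM -area3_middle1//.
rewrite -(mecke3 (ltW rho0) hX (f := fun p => (f3 p.1.1 p.1.2 * f3 p.1.2 p.2)%:E)).
- apply: eq_dsum => // -[//|c [//|b [//|a [|//]]]] /=.
  rewrite !inE !negb_or !andbT => /andP[/andP[cb ca] ba] _.
  rewrite (@integral_hops a b b c (path_keys a b ++ path_keys b c)).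
  + by econ; ring.
  + by ukeys.
  + by [].
- apply/measurable_EFinP.
  by apply: measurable_funM; apply: measurable_path3 => //; apply: measurableT_comp.
- by move=> p; rewrite lee_fin mulr_ge0 ?path3_ge0.
Qed.

Lemma hops_middle2 :
  dsum 3 [::] (fun u => \int[P]_w (hop u`#2 u`#1 w * hop u`#0 u`#2 w)%:E)
  = (rho ^+ 3 * (pi ^+ 3 / (12 * beta ^+ 3) * expR (- (3 * beta * sqdist x y / 4))))%:E.
Proof.
rewrite EFinM -area3_middle2//.
rewrite -(mecke3 (ltW rho0) hX (f := fun p => (f3 p.1.1 p.1.2 * f3 p.2 p.1.1)%:E)).
- apply: eq_dsum => // -[//|c [//|b [//|a [|//]]]] /=.
  rewrite !inE !negb_or !andbT => /andP[/andP[cb ca] ba] _.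
  rewrite (@integral_hops a b c a (path_keys a b ++ path_keys c a)).
  + by econ; ring.
  + by ukeys.
  + by [].
- apply/measurable_EFinP.
  by apply: measurable_funM; apply: measurable_path3 => //; apply: measurableT_comp.
- by move=> p; rewrite lee_fin mulr_ge0 ?path3_ge0.
Qed.

Lemma hops_disjoint :
  dsum 4 [::] (fun u => \int[P]_w (hop u`#3 u`#2 w * hop u`#1 u`#0 w)%:E)
  = (rho ^+ 4 * (I3 * I3))%:E.
Proof.
rewrite EFinM -area4_path3//.
rewrite -(mecke4 (ltW rho0) hX (f := fun p => (f3 p.1.1.1 p.1.1.2 * f3 p.1.2 p.2)%:E)).
- apply: eq_dsum => // -[//|e [//|c [//|b [//|a [|//]]]]] /=.
  rewrite !inE !negb_or !andbT => /andP[/and3P[ec eb ea] /andP[/andP[cb ca] ba]] _.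
  rewrite (@integral_hops a b c e (path_keys a b ++ path_keys c e)).
  + by econ; ring.
  + by ukeys.
  + by [].
- apply/measurable_EFinP.
  apply: measurable_funM; apply: measurable_path3 => //; apply: measurableT_comp => //;
    exact: measurableT_comp.
- by move=> p; rewrite lee_fin mulr_ge0 ?path3_ge0.
Qed.

Lemma integral_dsum_hops k (i j i' j' : nat) :
  \int[P]_w dsum k [::] (fun u => (hop u`#i u`#j w * hop u`#i' u`#j' w)%:E)
  = dsum k [::] (fun u => \int[P]_w (hop u`#i u`#j w * hop u`#i' u`#j' w)%:E).
Proof.
apply: integral_dsum => [u|w u]; last by rewrite lee_fin mulr_ge0// hop_ge0.
by apply/measurable_EFinP; apply: measurable_funM; exact: measurable_hop.
Qed.

Lemma measurable_dsum_hops k (i j i' j' : nat) : measurable_fun setT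
  (fun w => dsum k [::] (fun u => (hop u`#i u`#j w * hop u`#i' u`#j' w)%:E)).
Proof.
apply: measurable_dsum => [u|w u]; last by rewrite lee_fin mulr_ge0// hop_ge0.
by apply/measurable_EFinP; apply: measurable_funM; exact: measurable_hop.
Qed.

Lemma measurable_paths : measurable_fun setT paths.
Proof.
apply: measurable_dsum => [u|w u]; last by rewrite lee_fin hop_ge0.
by apply/measurable_EFinP; exact: measurable_hop.
Qed.

Lemma paths_ge0 w : 0 <= paths w.
Proof. by apply: dsum_ge0 => u; rewrite lee_fin hop_ge0. Qed.

(** [hop] takes the values 0 and 1, so the mean equals the contribution of coinciding paths to the
    second moment. *)
Lemma integral_paths : \int[P]_w paths w = (rho ^+ 2 * I3)%:E.
Proof.
rewrite EFinM -hops_same -integral_dsum_hops; apply: eq_integral => w _.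
apply: eq_dsum => // u _ _; congr (_%:E).
by rewrite /hop; case: all; rewrite ?mulr1 ?mulr0.
Qed.

(** A finite mean makes the count finite almost surely, so [fine] changes it only on a null set. *)
Lemma ae_paths_finite : {ae P, forall w, paths w = (sigma3 beta x y X U w)%:E}.
Proof.
have : P.-integrable setT paths.
  apply/integrableP; split; first exact: measurable_paths.
  rewrite (eq_integral paths); last by move=> w _; rewrite gee0_abs// paths_ge0.
  by rewrite integral_paths ltry.
move=> /(integrable_ae measurableT); apply: filterS => w fw.
by rewrite sigma3E fineK//; exact: fw.
Qed.

Lemma measurable_sigma3 : measurable_fun setT (sigma3 beta x y X U).
Proof.
rewrite (_ : sigma3 _ _ _ _ _ = fine \o paths); last by apply/funext => w; rewrite sigma3E.
by apply: measurableT_comp; [exact: fine_measurable|exact: measurable_paths].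
Qed.

Lemma sigma3_ge0 w : (0 <= sigma3 beta x y X U w)%R.
Proof. by rewrite sigma3E fine_ge0// paths_ge0. Qed.

Lemma integral_sigma3 : \int[P]_w (sigma3 beta x y X U w)%:E = (rho ^+ 2 * I3)%:E.
Proof.
rewrite -integral_paths; apply: ae_eq_integral => //.
- by apply/measurable_EFinP; exact: measurable_sigma3.
- exact: measurable_paths.
- by apply: filterS ae_paths_finite => w wE _; rewrite wE.
Qed.

Definition second_moment : R := (rho ^+ 2 * I3
  + (rho ^+ 2 * (pi ^+ 2 / (8 * beta ^+ 2) * expR (- (beta * sqdist x y)))
  + (rho ^+ 3 * (pi ^+ 3 / (8 * beta ^+ 3) * expR (- (beta * sqdist x y / 2)))
  + (rho ^+ 3 * (pi ^+ 3 / (12 * beta ^+ 3) * expR (- (3 * beta * sqdist x y / 4)))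
  + (rho ^+ 3 * (pi ^+ 3 / (12 * beta ^+ 3) * expR (- (3 * beta * sqdist x y / 4)))
  + (rho ^+ 3 * (pi ^+ 3 / (8 * beta ^+ 3) * expR (- (beta * sqdist x y / 2)))
  + rho ^+ 4 * (I3 * I3)))))))%R.

Lemma integral_sigma3_sq :
  \int[P]_w (sigma3 beta x y X U w * sigma3 beta x y X U w)%:E = second_moment%:E.
Proof.
pose D k i j i' j' w := dsum k [::] (fun u => (hop u`#i u`#j w * hop u`#i' u`#j' w)%:E).
have D0 k i j i' j' w : 0 <= D k i j i' j' w.
  by apply: dsum_ge0 => u; rewrite lee_fin mulr_ge0// hop_ge0.
have mD k i j i' j' : measurable_fun setT (D k i j i' j').
  exact: measurable_dsum_hops.
transitivity (\int[P]_w (D 2%N 1%N 0%N 1%N 0%N w + (D 2%N 1%N 0%N 0%N 1%N w +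
    (D 3%N 2%N 1%N 2%N 0%N w + (D 3%N 2%N 1%N 1%N 0%N w +
    (D 3%N 2%N 1%N 0%N 2%N w + (D 3%N 2%N 1%N 0%N 1%N w + D 4%N 3%N 2%N 1%N 0%N w))))))).
  apply: ae_eq_integral => //.
  - by apply/measurable_EFinP; apply: measurable_funM; exact: measurable_sigma3.
  - by repeat first [exact: mD | apply: emeasurable_funD].
  - apply: filterS ae_paths_finite => w wE _.
    exact: (dsum2_square (phi := fun a b => hop a b w) (fun a b => hop_ge0 a b w) wE).
have ID k i j i' j' : \int[P]_w D k i j i' j' w
    = dsum k [::] (fun u => \int[P]_w (hop u`#i u`#j w * hop u`#i' u`#j' w)%:E).
  exact: integral_dsum_hops.
clearbody D.
do 5 (rewrite ge0_integralD//; [|by move=> w _; rewrite !adde_ge0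
  |by repeat (apply: emeasurable_funD; first exact: mD); exact: mD]).
rewrite ge0_integralD//.
rewrite !ID /second_moment !EFinD; congr (_ + (_ + (_ + (_ + (_ + (_ + _)))))).
- by rewrite EFinM; exact: hops_same.
- exact: hops_rev.
- exact: hops_fork1.
- exact: hops_middle1.
- exact: hops_middle2.
- exact: hops_fork2.
- exact: hops_disjoint.
Qed.

Lemma expectation_sigma3 : 'E_P[sigma3 beta x y X U] = (rho ^+ 2 * I3)%:E.
Proof. by rewrite unlock integral_sigma3. Qed.

Lemma variance_sigma3 :
  'V_P[sigma3 beta x y X U] = (second_moment - (rho ^+ 2 * I3) ^+ 2)%:E.
Proof.
have L1 (f : T -> R) (m : R) : measurable_fun setT f -> (forall w, 0 <= f w)%R ->
    \int[P]_w (f w)%:E = m%:E -> f \in Lfun P 1.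
  move=> mf f0 fm; apply/Lfun1_integrable/integrableP; split; first exact/measurable_EFinP.
  under eq_integral do rewrite /= ger0_norm//.
  by rewrite fm ltry.
have ms := measurable_sigma3.
rewrite /variance covarianceE.
- by rewrite expectation_sigma3 unlock [X in X - _]integral_sigma3_sq expr2.
- exact: L1 ms sigma3_ge0 integral_sigma3.
- exact: L1 ms sigma3_ge0 integral_sigma3.
- apply: L1 integral_sigma3_sq; first exact: measurable_funM.
  by move=> w; rewrite mulr_ge0// sigma3_ge0.
Qed.

End three_hop_paths.

Local Close Scope ereal_scope.

Theorem mainTheorem3 (R : realType) (d : measure_display) (T : measurableType d)
  (P : probability T R) (rho beta : R) (x y : R * R)
  (X : nat -> T -> R * R) (U : nat -> nat -> T -> R) :
  0 < rho -> 0 < beta -> x != y ->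
  is_PPP P rho X ->
  iid_uniform_indep P X U ->
  let D2 := sqdist x y in
  let Esig := pi ^+ 2 * rho ^+ 2 / (3 * beta ^+ 2) * expR (- (beta * D2 / 3)) in
  ('E_P[sigma3 beta x y X U] = Esig%:E)%E /\
  ('V_P[sigma3 beta x y X U] =
    (Esig
     + pi ^+ 3 * rho ^+ 3 / beta ^+ 3 *
         (4^-1 * expR (- (beta * D2 / 2)) + 6^-1 * expR (- (3 * beta * D2 / 4)))
     + pi ^+ 2 * rho ^+ 2 / (8 * beta ^+ 2) * expR (- (beta * D2)))%:E)%E.
Proof.
move=> rho0 beta0 _ hX hU D2 Esig.
have EsigE : rho ^+ 2 * path3_int beta x y = Esig.
  by rewrite /path3_int /Esig mulrA [rho ^+ 2 * _]mulrCA mulrA.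
split; first by rewrite (expectation_sigma3 x y rho0 beta0 hX hU) EsigE.
rewrite (variance_sigma3 x y rho0 beta0 hX hU) /second_moment EsigE; congr (_%:E).
(* The quadruple term cancels the squared mean. Two forks at 1/8 give the coefficient 1/4, two
   middle patterns at 1/12 give 1/6, and the diamond gives the last term. *)
rewrite (_ : rho ^+ 4 * _ = Esig ^+ 2); last by rewrite -EsigE; ring.
have b0 : beta != 0 by rewrite gt_eqF.
rewrite /D2; move: (expR (- (beta * _))) (expR (- (beta * _ / 2)))
  (expR (- (3 * beta * _ / 4))) (pi : R) Esig {EsigE} => e1 e2 e3 p E.
by field.
Qed.
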